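(* Let $M$ be a closed complex submanifold of complex dimension $n$ in the complex projective space $\mathbb{C}P^{n+m}$ of constant holomorphic sectional curvature $c$, and let $f:M\to\mathbb{C}P^{n+m}$ be the inclusion. Then for every $p=0,1,\ldots,n$, $$L_{2p}=-(2n-2p)H^f_{2p+1}+\frac{cp(2n-2p)}{2(2n-2p+1)}H^f_{2p-1}=0,$$ i.e. $M$ is relatively $2p$-minimal for $p=0,1,\ldots,n$.
   Context: Let $f:M^d\to N^{d+q}$ be an isometric immersion of a closed manifold of real dimension $d$ into a Riemannian manifold of real dimension $d+q$ (in the claim $d=2n$, $q=2m$, $N=\mathbb CP^{n+m}$). Indices: $1\le i,j,i',j'\le d$, $d+1\le\alpha,\beta\le d+q$, $1\le A,B,C,D\le d+q$. $I_k=(i_1,\dots,i_k)$ (and likewise $J_k=(j_1,\dots,j_k)$) runs over ordered $k$-tuples of distinct integers in $\{1,\dots,d\}$; further single summation indices $i,i',j,j'$ run freely over $\{1,\dots,d\}$. $\delta^{i_1,\dots,i_k}_{j_1,\dots,j_k}$ is the generalized Kronecker symbol ($\pm1$ if the upper indices are distinct and the lower ones are an even/odd permutation of them, $0$ otherwise). The wedge product is normalized so that $(\theta_1\wedge\dots\wedge\theta_k)(e_1,\dots,e_k)=1$ for a frame with dual coframe $\theta_i$. Local orthonormal frames $e_A$ of $TN$ along $M$ have $e_i$ tangent and $e_\alpha$ normal to $M$. $\nabla$ is the Levi-Civita connection of $N$, $\mathrm{div}$ the divergence on $M$, $\theta_{AB}(X)=\langle\nabla_Xe_A,e_B\rangle$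 the connection forms, $R_{ABCD}$ the curvature components of $N$ with the sign convention that $R_{ABAB}$ is the sectional curvature of $e_A\wedge e_B$. $\Omega_{ij}=\sum_\alpha\theta_{i\alpha}\wedge\theta_{j\alpha}$ (restricted to $M$) are the relative curvature forms, and $\Omega_{I_{2p}}:=\Omega_{i_1i_2}\wedge\dots\wedge\Omega_{i_{2p-1}i_{2p}}$ ($\Omega_{I_0}=1$). The $(2p+1)$-th mean curvature vector field is $$H^f_{2p+1}=\tfrac{(d-2p-1)!}{d!}\sum_\alpha\sum_{I_{2p+1}}\Omega_{I_{2p}}\wedge\theta_{i_{2p+1}\alpha}(e_{i_1},\dots,e_{i_{2p+1}})e_\alpha,\qquad H^f_{-1}:=H^f_{d+1}:=0.$$ For $0\le p\le[\frac d2]$ define $L_{2p}:=-(d-2p)H^f_{2p+1}+pW_{2p-1}+p\widetilde Q_{2p-2}$, where $W_{-1}=\widetilde Q_{-2}=0$ and for $p\ge1$ $$\begin{aligned} W_{2p-1}={}&\tfrac{2(d-2p)!}{(2p-1)!\,d!}\sum_{\alpha,\beta}\sum_{I_{2p-1},i}\sum_{J_{2p-1},j}\delta^{i_1,\ldots,i_{2p-1},i}_{j_1,\ldots,j_{2p-1},j}R_{i\beta j\alpha}\,\Omega_{I_{2p-2}}\wedge\theta_{i_{2p-1}\beta}(e_{j_1},\ldots,e_{j_{2p-1}})\,e_\alpha\\ &+\tfrac{(d-2p)!}{(2p-1)!\,d!}\sum_{\alpha}\sum_{I_{2p-1},i,i'}\sum_{J_{2p-1},j'}\Big(\sum_j\delta^{i_1,\ldots,i_{2p-1},i,i'}_{j_1,\ldots,j_{2p-1},j,j'}R_{i'\alpha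 jj'}\,\Omega_{I_{2p-2}}\wedge\theta_{i_{2p-1}\alpha}(e_{j_1},\ldots,e_{j_{2p-1}})\\ &\qquad-2\,\delta^{i_1,\ldots,i_{2p-1},i'}_{j_1,\ldots,j_{2p-1},j'}R_{i'\alpha ij'}\,\Omega_{I_{2p-2}}\wedge\theta_{i_{2p-1}\alpha}(e_{j_1},\ldots,e_{j_{2p-1}})\Big)e_i, \end{aligned}$$ $$\begin{aligned} Q^i_{2p-2}={}&\tfrac{(d-2p)!}{(2p-2)!\,d!}\sum_\alpha\sum_{I_{2p-2},i'}\sum_{J_{2p-2},j,j'}\Big(\delta^{i_1,\ldots,i_{2p-2},i,i'}_{j_1,\ldots,j_{2p-2},j,j'}R_{i'\alpha jj'}\,\Omega_{I_{2p-2}}(e_{j_1},\dots,e_{j_{2p-2}})\\ &+2(p-1)\sum_{\beta}\delta^{i_1,\ldots,i_{2p-2},i,i'}_{j_1,\ldots,j_{2p-2},j,j'}R_{i'\beta jj'}\,\Omega_{I_{2p-4}}\wedge\theta_{i_{2p-3}\alpha}\wedge\theta_{i_{2p-2}\beta}(e_{j_1},\ldots,e_{j_{2p-2}})\Big)e_\alpha=:\sum_\alpha q^{i,\alpha}_{2p-2}e_\alpha, \end{aligned}$$ $$\widetilde{Q}_{2p-2}=\sum_{i,A}\langle Q^i_{2p-2},\nabla_{e_i}e_A\rangle e_A-\sum_\alpha \mathrm{div}\Big(\sum_i q^{i,\alpha}_{2p-2}e_i\Big)e_\alpha.$$ $L_{2p}=0$ is the Euler-Lagrange equation of the functional $\mathcal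 M_{2p}(f)=\int_MK^f_{2p}\,dV_M$, where $K^f_{2p}=\frac{(d-2p)!}{d!}\sum_{I_{2p}}\Omega_{I_{2p}}(e_{i_1},\dots,e_{i_{2p}})$; $M$ is called relatively $2p$-minimal if $L_{2p}=0$. The curvature tensor of $\mathbb CP^{n+m}$ with complex structure $J$ and constant holomorphic sectional curvature $c$ is $R(X,Y,Z,T)=\frac c4(\langle X,Z\rangle\langle Y,T\rangle-\langle Y,Z\rangle\langle X,T\rangle+\langle JX,Z\rangle\langle JY,T\rangle-\langle JY,Z\rangle\langle JX,T\rangle+2\langle JX,Y\rangle\langle JZ,T\rangle)$. *)

(* Defs.v *)
From HB Require Import structures.
From mathcomp Require Import all_boot all_order all_fingroup all_algebra.
From mathcomp Require Import all_classical reals topology normedtype derive.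

Set Implicit Arguments.
Unset Strict Implicit.
Unset Printing Implicit Defensive.

Import Order.TTheory GRing.Theory Num.Theory numFieldNormedType.Exports.

Local Open Scope classical_set_scope.
Local Open Scope ring_scope.

Section Alternation.
Variable R : realType.

(* Generalized Kronecker symbol of the index sequences s (upper) and t (lower).
   When s is duplicate-free, at most one permutation contributes to the sum. *)
Definition gkron d (s t : seq 'I_d) : R :=
  if uniq s then
    \sum_(σ : 'S_(size s) | t == [seq tnth (in_tuple s) (σ k) | k <- enum 'I_(size s)])
       (-1) ^+ σ
  else 0.

(* A k-form on V is used only through its values on sequences of k vectors;
   keeping the degree out of the type avoids casts between k + l and l + k. *)
Definition form (V : lmodType R) := seq V -> R.

Definition one_form (V : lmodType R) (w : V -> R) : form V := fun vs => w vs`_0.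

(* The factor 1 / (k! l!) gives (θ_1 ∧ ... ∧ θ_k)(e_1, ..., e_k) = 1. *)
Definition wedge (V : lmodType R) (k l : nat) (w w' : form V) : form V :=
  fun vs => (k`! * l`!)%:R^-1 *
    \sum_(σ : 'S_(k + l))
       (-1) ^+ σ * w [seq vs`_(σ (lshift l a)) | a <- enum 'I_k]
                 * w' [seq vs`_(σ (rshift k b)) | b <- enum 'I_l].

End Alternation.

Section RiemannianPatch.
Variables (R : realType) (D : nat).
Implicit Types (G : 'rV[R]_D -> 'M[R]_D) (y a b w : 'rV[R]_D).

(* C^infinity on an open set U: all iterated directional derivatives are
   (Fréchet) differentiable on U. *)
Definition smooth_on m (U : set 'rV[R]_D) (f : 'rV[R]_D -> 'rV[R]_m) : Prop :=
  forall (vs : seq 'rV[R]_D) (x : 'rV[R]_D), U x ->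
    differentiable (foldr (fun v g => 'D_v g) f vs) x.

Definition inner G y a b : R := (a *m G y *m b^T) 0 0.

(* Christoffel symbols: koszul G y a b w = <Γ_y(a, b), w>. *)
Definition koszul G y a b w : R :=
  2%:R^-1 * ('D_a (fun z => inner G z b w) y + 'D_b (fun z => inner G z a w) y
             - 'D_w (fun z => inner G z a b) y).

Definition christoffel G y a b : 'rV[R]_D :=
  (\row_l koszul G y a b (delta_mx 0 l)) *m invmx (G y).

(* R(a,b)w = ∇_a ∇_b w - ∇_b ∇_a w for constant (hence commuting) fields. *)
Definition curvature G y a b w : 'rV[R]_D :=
  'D_a (fun z => christoffel G z b w) y - 'D_b (fun z => christoffel G z a w) y
  + christoffel G y a (christoffel G y b w) - christoffel G y b (christoffel G y a w).

(* Sign: riemann G y X Y X Y is the sectional curvature of an orthonormal pair. *)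
Definition riemann G y X Y Z T : R := inner G y (curvature G y X Y T) Z.

Definition divergence G (Y : 'rV[R]_D -> 'rV[R]_D) (x : 'rV[R]_D) : R :=
  \sum_k ('D_(delta_mx 0 k) Y x + christoffel G x (delta_mx 0 k) (Y x)) 0 k.

End RiemannianPatch.

(* A local parametrization F of a d-dimensional submanifold inside a coordinate
   chart of the ambient manifold, with vector fields u_i on the parameter domain
   (the tangent part of a frame is e_i = dF(u_i)) and ambient fields ν_α along F
   (the normal part). *)
Record framed_patch (R : realType) (d q D : nat) := FramedPatch {
  patch_map : 'rV[R]_d -> 'rV[R]_D;
  tangent_fields : 'I_d -> 'rV[R]_d -> 'rV[R]_d;
  normal_fields : 'I_q -> 'rV[R]_d -> 'rV[R]_D
}.

Section Immersion.
Variables (R : realType) (d q D : nat).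
Variables (G : 'rV[R]_D -> 'M[R]_D) (P : framed_patch R d q D).

Local Notation F := (patch_map P).
Local Notation u := (tangent_fields P).
Local Notation nu := (normal_fields P).

Definition frame (A : 'I_(d + q)) (x : 'rV[R]_d) : 'rV[R]_D :=
  match fintype.split A with
  | inl i => 'D_(u i x) F x
  | inr al => nu al x
  end.

Local Notation tg := (lshift q).
Local Notation nm := (@rshift d q).

Definition adapted_frame (U : set 'rV[R]_d) : Prop :=
  [/\ forall i, smooth_on U (u i),
      forall al, smooth_on U (nu al) &
      forall x, U x -> forall A B : 'I_(d + q),
        inner G (F x) (frame A x) (frame B x) = (A == B)%:R].

(* Levi-Civita connection of the ambient metric, applied to a field X along F,
   in the direction dF(v). *)
Definition cov (v : 'rV[R]_d) (X : 'rV[R]_d -> 'rV[R]_D) (x : 'rV[R]_d) : 'rV[R]_D :=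
  'D_v X x + christoffel G (F x) ('D_v F x) (X x).

Definition theta (x : 'rV[R]_d) (A B : 'I_(d + q)) : form 'rV[R]_d :=
  one_form (fun v => inner G (F x) (cov v (frame A) x) (frame B x)).

Definition Rm (x : 'rV[R]_d) (A B C E : 'I_(d + q)) : R :=
  riemann G (F x) (frame A x) (frame B x) (frame C x) (frame E x).

Definition Omega (x : 'rV[R]_d) (i j : 'I_d) : form 'rV[R]_d :=
  fun vs => \sum_(al < q) wedge 1 1 (theta x (tg i) (nm al)) (theta x (tg j) (nm al)) vs.

(* Ω_I; used for sequences I of even length only. *)
Fixpoint OmegaI (x : 'rV[R]_d) (I : seq 'I_d) : form 'rV[R]_d :=
  match I with
  | i :: j :: I' => wedge 2 (size I') (Omega x i j) (OmegaI x I')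
  | _ => fun=> 1
  end.

(* Ω_I ∧ θ_{a α} *)
Definition OmegaTheta (x : 'rV[R]_d) (I : seq 'I_d) (a : 'I_d) (al : 'I_q) :=
  wedge (size I) 1 (OmegaI x I) (theta x (tg a) (nm al)).

(* Ω_I ∧ θ_{a α} ∧ θ_{b β} *)
Definition OmegaTheta2 (x : 'rV[R]_d) (I : seq 'I_d) (a : 'I_d) (al : 'I_q)
    (b : 'I_d) (be : 'I_q) :=
  wedge (size I).+1 1 (OmegaTheta x I a al) (theta x (tg b) (nm be)).

(* (e_{j_1}, ..., e_{j_k}), as tangent vectors of the parameter domain. *)
Definition es (x : 'rV[R]_d) (J : seq 'I_d) : seq 'rV[R]_d := [seq u j x | j <- J].

(* Below, a sum over ordered tuples (i_1, ..., i_{k+1}) of distinct indices is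
   written as a sum over (i_1, ..., i_k) = I and i_{k+1} = a whenever the last
   index plays a separate role. *)

(* mean_curv p is H^f_{2p-1}: H^f_{-1} = 0 and H^f_{2s+1} = 0 if 2s+1 > d. *)
Definition mean_curv (p : nat) (x : 'rV[R]_d) : 'rV[R]_D :=
  match p with
  | 0 => 0
  | s.+1 =>
    if (s.*2 < d)%N then
      ((d - s.*2 - 1)`!%:R / d`!%:R) *:
      \sum_(al < q)
        (\sum_(I : (s.*2).-tuple 'I_d) \sum_(a < d | uniq (rcons I a))
           OmegaTheta x I a al (es x (rcons I a))) *: frame (nm al) x
    else 0
  end.

(* W p is W_{2p-1}; in the successor case p = r + 1, so 2p - 2 = 2r. *)
Definition W (p : nat) (x : 'rV[R]_d) : 'rV[R]_D :=
  match p with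
  | 0 => 0
  | r.+1 =>
    (2%:R * (d - p.*2)`!%:R / ((p.*2 - 1)`!%:R * d`!%:R)) *:
    \sum_(al < q) \sum_(be < q)
      (\sum_(I : (r.*2).-tuple 'I_d) \sum_(a < d | uniq (rcons I a)) \sum_(i < d)
       \sum_(J : (r.*2.+1).-tuple 'I_d | uniq J) \sum_(j < d)
         gkron R (I ++ [:: a; i]) (J ++ [:: j])
         * Rm x (tg i) (nm be) (tg j) (nm al)
         * OmegaTheta x I a be (es x J)) *: frame (nm al) x
    +
    ((d - p.*2)`!%:R / ((p.*2 - 1)`!%:R * d`!%:R)) *:
    \sum_(al < q)
    \sum_(I : (r.*2).-tuple 'I_d) \sum_(a < d | uniq (rcons I a))
    \sum_(i < d) \sum_(i' < d)
    \sum_(J : (r.*2.+1).-tuple 'I_d | uniq J) \sum_(j' < d)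
      ((\sum_(j < d)
          gkron R (I ++ [:: a; i; i']) (J ++ [:: j; j'])
          * Rm x (tg i') (nm al) (tg j) (tg j')
          * OmegaTheta x I a al (es x J))
       - 2%:R * gkron R (I ++ [:: a; i']) (J ++ [:: j'])
         * Rm x (tg i') (nm al) (tg i) (tg j')
         * OmegaTheta x I a al (es x J)) *: frame (tg i) x
  end.

(* q_coef p i α is q^{i,α}_{2p-2}; in the successor case p = r + 1, and the
   second sum, carrying the factor 2(p - 1) = 2r, is present for r = s + 1,
   when 2p - 4 = 2s. *)
Definition q_coef (p : nat) (i : 'I_d) (al : 'I_q) (x : 'rV[R]_d) : R :=
  match p with
  | 0 => 0
  | r.+1 =>
    ((d - p.*2)`!%:R / ((p.*2 - 2)`!%:R * d`!%:R)) *
    ((\sum_(I : (r.*2).-tuple 'I_d | uniq I) \sum_(i' < d)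
      \sum_(J : (r.*2).-tuple 'I_d | uniq J) \sum_(j < d) \sum_(j' < d)
        gkron R (I ++ [:: i; i']) (J ++ [:: j; j'])
        * Rm x (tg i') (nm al) (tg j) (tg j')
        * OmegaI x I (es x J))
     +
     match r with
     | 0 => 0
     | s.+1 =>
       \sum_(I : (s.*2).-tuple 'I_d) \sum_(a < d) \sum_(b < d | uniq (I ++ [:: a; b]))
       \sum_(i' < d)
       \sum_(J : (r.*2).-tuple 'I_d | uniq J) \sum_(j < d) \sum_(j' < d)
         2%:R * r%:R * \sum_(be < q)
           gkron R (I ++ [:: a; b; i; i']) (J ++ [:: j; j'])
           * Rm x (tg i') (nm be) (tg j) (tg j')
           * OmegaTheta2 x I a al b be (es x J)
     end)
  end.

(* Q p i is Q^i_{2p-2}. *)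
Definition Q (p : nat) (i : 'I_d) (x : 'rV[R]_d) : 'rV[R]_D :=
  \sum_(al < q) q_coef p i al x *: frame (nm al) x.

Definition induced_metric (x : 'rV[R]_d) : 'M[R]_d :=
  \matrix_(k, l) inner G (F x) ('D_(delta_mx 0 k) F x) ('D_(delta_mx 0 l) F x).

(* Qtilde p is the field Q~_{2p-2}. *)
Definition Qtilde (p : nat) (x : 'rV[R]_d) : 'rV[R]_D :=
  \sum_(i < d) \sum_(A < d + q)
     inner G (F x) (Q p i x) (cov (u i x) (frame A) x) *: frame A x
  - \sum_(al < q)
     divergence induced_metric (fun z => \sum_(i < d) q_coef p i al z *: u i z) x
       *: frame (nm al) x.

(* EL p is L_{2p}. *)
Definition EL (p : nat) (x : 'rV[R]_d) : 'rV[R]_D :=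
  - ((d - p.*2)%:R *: mean_curv p.+1 x) + p%:R *: W p x + p%:R *: Qtilde p x.

End Immersion.

(* C^N is 'rV[R]_(N + N), the vector (x | y) standing for x + iy. *)
Section ComplexProjectiveSpace.
Variable R : realType.

Definition cJ N (v : 'rV[R]_(N + N)) : 'rV[R]_(N + N) := row_mx (- rsubmx v) (lsubmx v).

Lemma cJZD N (a : R) (v w : 'rV[R]_(N + N)) : cJ (a *: v + w) = a *: cJ v + cJ w.
Proof.
rewrite /cJ scale_row_mx add_row_mx scalerN -opprD.
by congr (row_mx (- _) _); exact: linearP.
Qed.

Lemma cJK N (v : 'rV[R]_(N + N)) : cJ (cJ v) = - v.
Proof. by rewrite /cJ row_mxKl row_mxKr -opp_row_mx hsubmxK. Qed.

Variable N : nat.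

Definition nonzero_vec := {w : 'rV[R]_(N.+1 + N.+1) | w != 0}.
HB.instance Definition _ := Choice.on nonzero_vec.

Definition punctured := initial_topology (val : nonzero_vec -> 'rV[R]_(N.+1 + N.+1)).
HB.instance Definition _ := Topological.on punctured.
HB.instance Definition _ := Choice.on punctured.

(* w' = (a + ib) w; since w' is nonzero, so is a + ib. *)
Definition collinear (w w' : punctured) : bool :=
  `[< exists a b : R, val w' = a *: val w + b *: cJ (val w) >].

Lemma collinear_equiv : equiv_class_of collinear.
Proof.
have mulC (a b a' b' : R) (v : 'rV[R]_(N.+1 + N.+1)) :
  a' *: (a *: v + b *: cJ v) + b' *: cJ (a *: v + b *: cJ v)
  = (a' * a - b' * b) *: v + (a' * b + b' * a) *: cJ v.
  rewrite cJZD -[b *: cJ v]addr0 cJZD cJK.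
  have -> : cJ (0 : 'rV[R]_(N.+1 + N.+1)) = 0.
    by have := cJZD (-1) (0 : 'rV[R]_(N.+1 + N.+1)) 0;
      rewrite scaler0 addr0 scaleN1r addNr.
  rewrite !addr0 !scalerDr !scalerA scalerN -!addrA scalerBl scalerDl.
  rewrite -!addrA; congr (_ + _); rewrite [RHS]addrCA; congr (_ + _).
  by rewrite addrC.
split.
- by move=> w; apply/asboolP; exists 1, 0; rewrite scale1r scale0r addr0.
- suff S (w w' : punctured) : collinear w w' -> collinear w' w.
    by move=> w w'; apply/idP/idP; exact: S.
  move=> /asboolP[a [b e]]; apply/asboolP.
  have r0 : a ^+ 2 + b ^+ 2 != 0.
    apply: contraNneq (valP w') => /eqP.
    rewrite paddr_eq0 ?sqr_ge0// !sqrf_eq0 => /andP[/eqP a0 /eqP b0].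
    by rewrite e a0 b0 !scale0r addr0.
  exists (a / (a ^+ 2 + b ^+ 2)), (- b / (a ^+ 2 + b ^+ 2)); rewrite e mulC.
  set r := a ^+ 2 + b ^+ 2 in r0 *.
  have -> : a / r * a - - b / r * b = 1.
    by rewrite !mulNr opprK mulrAC [b / r * b]mulrAC -mulrDl -!expr2 divff.
  have -> : a / r * b + - b / r * a = 0.
    by rewrite !mulNr mulrAC [b / r * a]mulrAC [b * a]mulrC subrr.
  by rewrite scale1r scale0r addr0.
- move=> w2 w1 w3 /asboolP[a [b e]] /asboolP[a' [b' e']]; apply/asboolP.
  by rewrite e' e mulC; do 2 eexists.
Qed.

Canonical collinear_equivRel := EquivRelPack collinear_equiv.

Definition CP := quotient_topology {eq_quot collinear_equivRel}%qT.

(* Homogeneous coordinates: the entry t is inserted at position k in z. *)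
Definition insert_row (k : 'I_N.+1) (t : R) (v : 'rV[R]_N) : 'rV[R]_N.+1 :=
  \row_j oapp (fun j' => v 0 j') t (unlift k j).

Definition homog (k : 'I_N.+1) (t : R) (z : 'rV[R]_(N + N)) : 'rV[R]_(N.+1 + N.+1) :=
  row_mx (insert_row k t (lsubmx z)) (insert_row k 0 (rsubmx z)).

Lemma homog1_neq0 k z : homog k 1 z != 0.
Proof.
apply/eqP => /matrixP /(_ 0 (lshift N.+1 k)).
by rewrite row_mxEl !mxE unlift_none /=; apply/eqP; rewrite oner_eq0.
Qed.

Definition affine_point (k : 'I_N.+1) (z : 'rV[R]_(N + N)) : CP :=
  \pi_({eq_quot collinear_equivRel})%qT
    (exist (fun w => w != 0) (homog k 1 z) (homog1_neq0 k z) : punctured).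

Definition dot m (a b : 'rV[R]_m) : R := (a *m b^T) 0 0.

(* Fubini-Study metric at [w], of constant holomorphic sectional curvature c, on
   C^(N+1) / C w: the quotient of the round metric of the sphere of radius
   2 / sqrt c by the Hopf action. *)
Definition fubini_study (c : R) (w xi eta : 'rV[R]_(N.+1 + N.+1)) : R :=
  4%:R / c * (dot w w * dot xi eta - dot xi w * dot eta w
              - dot xi (cJ w) * dot eta (cJ w)) / dot w w ^+ 2.

(* Its expression in the k-th affine chart, through the section
   z |-> homog k 1 z, whose differential is v |-> homog k 0 v. *)
Definition fs_metric (c : R) (k : 'I_N.+1) (z : 'rV[R]_(N + N)) : 'M[R]_(N + N) :=
  \matrix_(i, j) fubini_study c (homog k 1 z)
                   (homog k 0 (delta_mx 0 i)) (homog k 0 (delta_mx 0 j)).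

(* F : U -> C^N, read in the k-th affine chart, is a holomorphic embedding onto a
   relatively open part of M: a smooth immersion with complex linear differential,
   injective, and open onto its image for the topology induced on M. *)
Definition holomorphic_param n (M : set CP) (k : 'I_N.+1) (U : set 'rV[R]_(n + n))
    (F : 'rV[R]_(n + n) -> 'rV[R]_(N + N)) : Prop :=
  [/\ open U /\ smooth_on U F,
      forall x, U x -> forall v, 'D_v F x = 0 -> v = 0,
      forall x, U x -> forall v, 'D_(cJ v) F x = cJ ('D_v F x),
      forall x y, U x -> U y -> F x = F y -> x = y &
      forall V : set 'rV[R]_(n + n), open V -> V `<=` U ->
        exists O : set CP, open O /\ [set affine_point k (F x) | x in V] = M `&` O].

Definition complex_submanifold n (M : set CP) : Prop :=
  forall y, M y -> exists (k : 'I_N.+1) (U : set 'rV[R]_(n + n))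
                          (F : 'rV[R]_(n + n) -> 'rV[R]_(N + N)),
    holomorphic_param M k U F /\ exists2 x, U x & affine_point k (F x) = y.

Definition closed_complex_submanifold n (M : set CP) : Prop :=
  compact M /\ complex_submanifold n M.

(* P is a holomorphic parametrization of M over U, in the k-th affine chart,
   together with an orthonormal frame of T(CP^N) along M adapted to M. *)
Definition framed_param c n q (M : set CP) (k : 'I_N.+1) (U : set 'rV[R]_(n + n))
    (P : framed_patch R (n + n) q (N + N)) : Prop :=
  holomorphic_param M k U (patch_map P) /\ adapted_frame (fs_metric c k) P U.

(* L_{2p} = 0 on M; the codimension is q = 2N - 2n. *)
Definition relatively_minimal c n q (M : set CP) (p : nat) : Prop :=
  forall (k : 'I_N.+1) (U : set 'rV[R]_(n + n)) (P : framed_patch R (n + n) q (N + N)),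
    framed_param c M k U P ->
    forall x, U x -> EL (fs_metric c k) P p x = 0.

End ComplexProjectiveSpace.

(* Main.v *)
Require Import Defs.
From mathcomp Require Import all_boot all_order all_fingroup all_algebra.
From mathcomp Require Import all_classical reals topology normedtype derive landau.
From mathcomp Require Import ring lra.

Set Implicit Arguments.
Unset Strict Implicit.
Unset Printing Implicit Defensive.

Import Order.TTheory GRing.Theory Num.Theory numFieldNormedType.Exports.

Local Open Scope classical_set_scope.
Local Open Scope ring_scope.

(** The complex structure J of the tangent space, written in the frame e_i, is an
    orthogonal matrix O.  On a complex submanifold of a Kaehler manifold the second
    fundamental form satisfies h(Jv, Jw) = - h(v, w), that is O h O^T = - h for every
    matrix h^alpha = (theta_(i alpha)(e_j)).  The normal components of H_(2p+1) and of
    W_(2p-1) are full contractions of tensors that contain an odd number of factors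
    h^alpha; the remaining factors are the forms Omega (even in h) and, for W, the matrix
    R_(i beta j alpha), which is O-invariant since for constant holomorphic curvature it
    is a combination of 1 and O.  A full contraction does not change under the orthogonal
    substitution O, while parity multiplies it by -1, so it vanishes; no J-adapted frame
    is needed.  Finally R_(i' alpha j j') = 0, because the tangent spaces are J-invariant:
    this kills the tangential part of W and the coefficients q, hence Q~. *)

(** * Contractions of tensors and orthogonal changes of basis *)

Section TupleSums.
Variables (R : realType) (T : finType).

(** Tuples are split and permuted by position, so that entries are computed by [tnth_mktuple] and
    lengths stay in the form [k + l] without casts. *)
Definition ltuple k l (S : (k + l).-tuple T) : k.-tuple T :=
  [tuple tnth S (lshift l i) | i < k].
Definition rtuple k l (S : (k + l).-tuple T) : l.-tuple T :=
  [tuple tnth S (rshift k i) | i < l].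
Definition ptuple k (s : 'S_k) (S : k.-tuple T) : k.-tuple T :=
  [tuple tnth S (s i) | i < k].

Lemma ltuple_cat k l (A : k.-tuple T) (B : l.-tuple T) :
  ltuple (cat_tuple A B) = A.
Proof. by apply: eq_from_tnth => i; rewrite tnth_mktuple tnth_lshift. Qed.

Lemma rtuple_cat k l (A : k.-tuple T) (B : l.-tuple T) :
  rtuple (cat_tuple A B) = B.
Proof. by apply: eq_from_tnth => i; rewrite tnth_mktuple tnth_rshift. Qed.

Lemma cat_lrtuple k l (S : (k + l).-tuple T) :
  cat_tuple (ltuple S) (rtuple S) = S.
Proof.
apply: eq_from_tnth => i; case: (split_ordP i) => j ->.
  by rewrite tnth_lshift tnth_mktuple.
by rewrite tnth_rshift tnth_mktuple.
Qed.

Lemma ptuple1 k (S : k.-tuple T) : ptuple 1%g S = S.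
Proof. by apply: eq_from_tnth => i; rewrite tnth_mktuple perm1. Qed.

Lemma ptupleK k (s : 'S_k) : cancel (ptuple s) (ptuple s^-1).
Proof. by move=> S; apply: eq_from_tnth => i; rewrite !tnth_mktuple permKV. Qed.

Lemma big_tuple_cat k l (F : (k + l).-tuple T -> R) :
  \sum_(S : (k + l).-tuple T) F S =
  \sum_(A : k.-tuple T) \sum_(B : l.-tuple T) F (cat_tuple A B).
Proof.
rewrite pair_big /= (reindex (fun p => cat_tuple p.1 p.2)) //=.
exists (fun S => (ltuple S, rtuple S)) => [[A B] _|S _] /=.
  by rewrite ltuple_cat rtuple_cat.
exact: cat_lrtuple.
Qed.

Lemma big_tuple_prod k (f : 'I_k -> T -> R) :
  \sum_(S : k.-tuple T) \prod_(i < k) f i (tnth S i) = \prod_(i < k) \sum_t f i t.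
Proof.
rewrite bigA_distr_bigA (reindex (@tuple_of_finfun T k)); last first.
  exists (@finfun_of_tuple T k) => S _; [exact: tuple_of_finfunK|exact: finfun_of_tupleK].
by apply: eq_bigr => g _; apply: eq_bigr => i _; rewrite tnth_mktuple.
Qed.

Lemma big_tuple1 (F : 1.-tuple T -> R) :
  \sum_(S : 1.-tuple T) F S = \sum_t F [tuple t].
Proof.
rewrite (reindex (fun t => [tuple t])) //=.
exists (fun S => tnth S ord0) => [t _|S _]; first by rewrite (tnth_nth t).
by apply: eq_from_tnth => i; rewrite (ord1 i) [LHS](tnth_nth (tnth S ord0)).
Qed.

(** The summand lives on sequences, so lengths that are equal but not convertible can be exchanged
    without transporting tuples. *)
Lemma big_tuple_cast k k' (F : seq T -> R) : k = k' ->
  \sum_(S : k.-tuple T) F S = \sum_(S : k'.-tuple T) F S.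
Proof. by move=> ->. Qed.

End TupleSums.

Section OrthogonalInvariance.
Variables (R : realType) (d : nat) (O : 'M[R]_d).
Hypothesis O_orth : O^T *m O = 1%:M.

(** The entry at row S and column S' of the k-fold tensor power of O. *)
Definition tmul k (S S' : k.-tuple 'I_d) : R :=
  \prod_(i < k) O (tnth S i) (tnth S' i).

Lemma tmul_cat k l (S S' : (k + l).-tuple 'I_d) :
  tmul S S' = tmul (ltuple S) (ltuple S') * tmul (rtuple S) (rtuple S').
Proof.
rewrite /tmul big_split_ord /=.
by congr (_ * _); apply: eq_bigr => i _; rewrite !tnth_mktuple.
Qed.

Lemma tmul_perm k (s : 'S_k) (S S' : k.-tuple 'I_d) :
  tmul (ptuple s S) (ptuple s S') = tmul S S'.
Proof.
rewrite /tmul [RHS](reindex_inj (@perm_inj _ s)).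
by apply: eq_bigr => i _; rewrite !tnth_mktuple.
Qed.

(** A tensor power of an orthogonal matrix is orthogonal: the sum factors over the slots, and each
    slot contributes an entry of O^T O. *)
Lemma tmul_orth k (S' S'' : k.-tuple 'I_d) :
  \sum_(S : k.-tuple 'I_d) tmul S S' * tmul S S'' = (S' == S'')%:R.
Proof.
under eq_bigr do rewrite -big_split /=.
rewrite (big_tuple_prod (fun i t => O t (tnth S' i) * O t (tnth S'' i))).
rewrite (eq_bigr (fun i => (tnth S' i == tnth S'' i)%:R)); last first.
  move=> i _; have /matrixP/(_ (tnth S' i) (tnth S'' i)) := O_orth.
  by rewrite !mxE => <-; apply: eq_bigr => j _; rewrite mxE.
case: eqP => [->|neq]; first by rewrite big1 // => i _; rewrite eqxx.
have /existsP[i ni] : [exists i, tnth S' i != tnth S'' i].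
  rewrite -negb_forall; apply/negP => /forallP e; apply: neq.
  by apply: eq_from_tnth => i; apply/eqP.
by rewrite (bigD1 i) //= (negbTE ni) mul0r.
Qed.

(* The change of basis O in all 2k slots multiplies Phi by [eps]. *)
Definition tensor_parity k (eps : R) (Phi : k.-tuple 'I_d -> k.-tuple 'I_d -> R) :=
  forall S T, \sum_S' \sum_T' tmul S S' * tmul T T' * Phi S' T' = eps * Phi S T.

Lemma parity_ext k eps (Phi Psi : k.-tuple 'I_d -> k.-tuple 'I_d -> R) :
  (forall S T, Phi S T = Psi S T) -> tensor_parity eps Phi -> tensor_parity eps Psi.
Proof.
move=> e h S T; rewrite -e -h.
by apply: eq_bigr => S' _; apply: eq_bigr => T' _; rewrite e.
Qed.

Lemma parity_scale k eps (c : R) (Phi : k.-tuple 'I_d -> k.-tuple 'I_d -> R) :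
  tensor_parity eps Phi -> tensor_parity eps (fun S T => c * Phi S T).
Proof.
move=> h S T; rewrite mulrCA -h mulr_sumr; apply: eq_bigr => S' _.
by rewrite mulr_sumr; apply: eq_bigr => T' _; rewrite mulrCA.
Qed.

Lemma parity_sum (I : finType) k eps (Phi : I -> k.-tuple 'I_d -> k.-tuple 'I_d -> R) :
  (forall i, tensor_parity eps (Phi i)) ->
  tensor_parity eps (fun S T => \sum_i Phi i S T).
Proof.
move=> h S T; rewrite mulr_sumr -(eq_bigr _ (fun i _ => h i S T)).
rewrite [RHS]exchange_big; apply: eq_bigr => S' _.
by rewrite [RHS]exchange_big; apply: eq_bigr => T' _; rewrite mulr_sumr.
Qed.

(** Permuting slots commutes with the tensor power of O, because [tmul] is unchanged when both of
    its arguments are permuted alike. *)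
Lemma parity_perm k eps (s : 'S_k) (Phi : k.-tuple 'I_d -> k.-tuple 'I_d -> R) :
  tensor_parity eps Phi -> tensor_parity eps (fun S T => Phi S (ptuple s T)).
Proof.
move=> h S T; rewrite -h; apply: eq_bigr => S' _.
rewrite [RHS](reindex_inj (can_inj (ptupleK s))).
by apply: eq_bigr => T' _; rewrite tmul_perm.
Qed.

Lemma parity_prod k l eps eps' (Phi : k.-tuple 'I_d -> k.-tuple 'I_d -> R)
    (Psi : l.-tuple 'I_d -> l.-tuple 'I_d -> R) :
  tensor_parity eps Phi -> tensor_parity eps' Psi ->
  @tensor_parity (k + l) (eps * eps')
    (fun S T => Phi (ltuple S) (ltuple T) * Psi (rtuple S) (rtuple T)).
Proof.
move=> h h' S T; rewrite mulrACA -h -h' big_tuple_cat mulr_suml.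
apply: eq_bigr => A _; rewrite mulr_sumr; apply: eq_bigr => B _.
rewrite big_tuple_cat mulr_suml; apply: eq_bigr => C _.
rewrite mulr_sumr; apply: eq_bigr => D _.
rewrite !tmul_cat !ltuple_cat !rtuple_cat -!mulrA.
by rewrite ![_ * (Phi _ _ * _)]mulrCA ![_ * (tmul (ltuple T) _ * _)]mulrCA;
  congr (_ * (_ * _));
  rewrite mulrCA; congr (_ * _); rewrite mulrCA.
Qed.

Lemma parity1 eps (A : 'M[R]_d) : O *m A *m O^T = eps *: A ->
  @tensor_parity 1 eps (fun S T => A (tnth S 0) (tnth T 0)).
Proof.
move=> /matrixP h S T; have := h (tnth S 0) (tnth T 0).
rewrite !mxE => <-; rewrite big_tuple1 exchange_big big_tuple1 /=.
apply: eq_bigr => j _; rewrite !mxE big_distrl /=; apply: eq_bigr => i _.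
by rewrite /tmul !big_ord1 /= !(tnth_nth j) /= mulrAC.
Qed.

(** After the sums are exchanged, summing over S leaves a product of two [tmul] factors, which
    orthogonality turns into a Kronecker delta of S' and T'. A full contraction thus does not see
    the change of basis, while parity multiplies it by [eps]. *)
Lemma parity_trace k eps (s : 'S_k) (Phi : k.-tuple 'I_d -> k.-tuple 'I_d -> R) :
  tensor_parity eps Phi ->
  \sum_S Phi S (ptuple s S) = eps * \sum_S Phi S (ptuple s S).
Proof.
move=> /(parity_perm s) h; rewrite [in RHS]mulr_sumr -(eq_bigr _ (fun S _ => h S S)).
rewrite exchange_big /=; apply: eq_bigr => S' _.
rewrite exchange_big (bigD1 S') //= [X in _ + X]big1 ?addr0.
  by rewrite -mulr_suml tmul_orth eqxx mul1r.
by move=> T' /negbTE ne; rewrite -mulr_suml tmul_orth eq_sym ne mul0r.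
Qed.

Lemma odd_trace_eq0 k (s : 'S_k) (Phi : k.-tuple 'I_d -> k.-tuple 'I_d -> R) :
  tensor_parity (-1) Phi -> \sum_S Phi S (ptuple s S) = 0.
Proof.
move=> h; apply/eqP; rewrite -eqNr -mulN1r; apply/eqP.
by rewrite -(parity_trace s h).
Qed.

End OrthogonalInvariance.

(** * Generalized Kronecker symbols as signed sums over permutations *)

Section Antisymmetry.
Variables (R : realType) (d : nat).

(** Composing with the transposition of two positions that carry equal entries changes every sign
    and no value, so the sum equals its own negative. *)
Lemma antisym_sum_eq0 (T : finType) k (f : k.-tuple T -> R) (S : k.-tuple T) :
  ~~ uniq S -> \sum_(s : 'S_k) (-1) ^+ s * f (ptuple s S) = 0.
Proof.
move=> nu; have [i [j [ij Sij]]] : exists i j, i != j /\ tnth S i = tnth S j.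
  apply: contrapT => h; move/negP: nu; apply; apply/tuple_uniqP => i j Sij.
  by apply: contrapT => /eqP ij; apply: h; exists i, j.
apply/eqP; rewrite -eqNr -sumrN (reindex_inj (mulIg (tperm i j))) /=.
apply/eqP; apply: eq_bigr => s _.
rewrite odd_permM odd_tperm ij signr_addb mulrN1 mulNr opprK; congr (_ * f _).
apply: eq_from_tnth => a; rewrite !tnth_mktuple permM.
by case: tpermP => [->|->|].
Qed.

(** Fixing the length k moves the permutations from ['S_(size s)] to ['S_k], where they act by
    [ptuple]. *)
Lemma gkronE k (S T : k.-tuple 'I_d) :
  gkron R S T = if uniq S then \sum_(s : 'S_k | T == ptuple s S) (-1) ^+ s else 0.
Proof.
rewrite /gkron; case: S => S hS /=; case: (uniq S) => //.
have e := eqP hS; case: k / e hS T => hS T; apply: eq_bigl => s; rewrite -val_eqE /=.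
by congr (_ == _); apply: eq_map => i; 
rewrite [LHS](tnth_nth (tnth (in_tuple S) i)) [RHS](tnth_nth (tnth (in_tuple S) i)).
Qed.

(** For duplicate-free S the symbol selects the T that are rearrangements of S. For the other S the
    left side is zero by definition and the right side by antisymmetry, so S may range over all
    tuples and each permutation yields a full contraction. *)
Lemma gkron_sum k (Phi : k.-tuple 'I_d -> k.-tuple 'I_d -> R) :
  \sum_(S : k.-tuple 'I_d) \sum_(T : k.-tuple 'I_d) gkron R S T * Phi S T =
  \sum_(s : 'S_k) (-1) ^+ s * \sum_(S : k.-tuple 'I_d) Phi S (ptuple s S).
Proof.
under [RHS]eq_bigr do rewrite mulr_sumr.
rewrite [RHS]exchange_big; apply: eq_bigr => S _ /=.
have [uS|nuS] := boolP (uniq S); last first.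
  rewrite antisym_sum_eq0 // big1 // => T _.
  by rewrite gkronE (negbTE nuS) mul0r.
transitivity (\sum_(T : k.-tuple 'I_d) \sum_(s : 'S_k)
  if T == ptuple s S then (-1) ^+ s * Phi S T else 0).
  by apply: eq_bigr => T _; rewrite gkronE uS mulr_suml big_mkcond.
rewrite exchange_big; apply: eq_bigr => s _ /=.
by rewrite -big_mkcond /= big_pred1_eq.
Qed.

(** This allows the distinctness conditions on upper and lower indices to be dropped wherever the
    symbol is a factor. *)
Lemma gkron_uniq (s t : seq 'I_d) : ~~ (uniq s && uniq t) -> gkron R s t = 0.
Proof.
rewrite /gkron; case: ifP => //= us nut; rewrite big1 // => σ /eqP e.
move/negP: nut; case; rewrite e map_inj_uniq ?enum_uniq //.
by apply: inj_comp (@perm_inj _ σ); exact/tuple_uniqP.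
Qed.

End Antisymmetry.

(** * Wedge products evaluated on frame vectors *)

Section WedgeParity.
Variables (R : realType) (d : nat) (V : lmodType R) (v : 'I_d -> V) (O : 'M[R]_d).

Lemma wedge_frame k l (w w' : Defs.form V) (T : (k + l).-tuple 'I_d) :
  wedge k l w w' [seq v j | j <- T] =
  (k`! * l`!)%:R^-1 * \sum_(s : 'S_(k + l)) (-1) ^+ s *
    (w [seq v j | j <- ltuple (ptuple s T)] * w' [seq v j | j <- rtuple (ptuple s T)]).
Proof.
rewrite /wedge; congr (_ * _); apply: eq_bigr => s _; rewrite -mulrA.
congr (_ * (w _ * w' _)).
  rewrite -(map_tnth_enum (ltuple _)) -[RHS]map_comp; apply: eq_map => a /=.
  by rewrite !tnth_mktuple -(tnth_nth 0 (map_tuple v T)) tnth_map.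
rewrite -(map_tnth_enum (rtuple _)) -[RHS]map_comp; apply: eq_map => a /=.
by rewrite !tnth_mktuple -(tnth_nth 0 (map_tuple v T)) tnth_map.
Qed.

(** Used to extend sums over distinct indices to sums over all tuples. *)
Lemma wedge_not_uniq k l (w w' : Defs.form V) (T : (k + l).-tuple 'I_d) :
  ~~ uniq T -> wedge k l w w' [seq v j | j <- T] = 0.
Proof.
move=> nu; rewrite wedge_frame.
rewrite (antisym_sum_eq0
  (fun T => w [seq v j | j <- ltuple T] * w' [seq v j | j <- rtuple T]) nu).
by rewrite mulr0.
Qed.

(** On frame vectors a wedge product is a linear combination of tensor products whose lower slots
    are permuted, so parities multiply. *)
Lemma parity_wedge k l eps eps' (w : k.-tuple 'I_d -> Defs.form V)
    (w' : l.-tuple 'I_d -> Defs.form V) :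
  tensor_parity O eps (fun S (T : k.-tuple 'I_d) => w S [seq v j | j <- T]) ->
  tensor_parity O eps' (fun S (T : l.-tuple 'I_d) => w' S [seq v j | j <- T]) ->
  @tensor_parity R d O (k + l) (eps * eps') (fun S T =>
    wedge k l (w (ltuple S)) (w' (rtuple S)) [seq v j | j <- T]).
Proof.
move=> h h'; apply: parity_ext => [S T|]; first by symmetry; exact: wedge_frame.
apply: parity_scale; apply: parity_sum => s; apply: parity_scale.
exact: (parity_perm s (parity_prod h h')).
Qed.

End WedgeParity.

(** * Parity of the curvature forms and the contractions that vanish by it *)

Section ParityOfCurvatureForms.
Variables (R : realType) (d q D : nat) (G : 'rV[R]_D -> 'M[R]_D).
Variables (P : framed_patch R d q D) (x : 'rV[R]_d) (O : 'M[R]_d).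

Local Notation u := (tangent_fields P).
Local Notation tg := (lshift q).
Local Notation nm := (@rshift d q).

Definition second_form (al : 'I_q) : 'M[R]_d :=
  \matrix_(a, b) theta G P x (tg a) (nm al) [:: u b x].

Hypothesis O_orth : O^T *m O = 1%:M.
Hypothesis second_form_odd : forall al,
  O *m second_form al *m O^T = (-1) *: second_form al.

Lemma parity_theta al : @tensor_parity R d O 1 (-1)
  (fun S T => theta G P x (tg (tnth S 0)) (nm al) [seq u j x | j <- T]).
Proof.
apply: parity_ext (parity1 (second_form_odd al)) => S T; rewrite mxE.
congr (theta _ _ _ _ _ _); rewrite -[in RHS](map_tnth_enum T).
by rewrite enum_ordSl enum_ord0.
Qed.

Lemma parity_Omega : @tensor_parity R d O 2 1
  (fun S T => Omega G P x (tnth S 0) (tnth S 1) [seq u j x | j <- T]).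
Proof.
apply: parity_sum => al.
have := parity_wedge (v := u^~ x)
  (w := fun S => theta G P x (tg (tnth S 0)) (nm al))
  (w' := fun S => theta G P x (tg (tnth S 0)) (nm al)) (parity_theta al) (parity_theta al).
rewrite mulrNN mulr1; apply: parity_ext => S T.
have -> : tnth (ltuple S) 0 = tnth S 0 by rewrite tnth_mktuple; congr tnth; exact: val_inj.
by have -> : tnth (rtuple S) 0 = tnth S 1 by rewrite tnth_mktuple; congr tnth; exact: val_inj.
Qed.

Lemma parity_OmegaI r : @tensor_parity R d O r.*2 1
  (fun S T => OmegaI G P x S [seq u j x | j <- T]).
Proof.
elim: r => [|r IHr].
  move=> S T.
  (* There is only one empty tuple, so both sums have a single term, with empty products as
     coefficients. *)
  have all0 (A B : 0.-tuple 'I_d) : (A == B) = true by rewrite (tuple0 A) (tuple0 B).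
  rewrite (big_pred1 S) => [|S'] /=; last by rewrite all0.
  rewrite (big_pred1 T) => [|T'] /=; last by rewrite all0.
  by rewrite /tmul !big_ord0 !mulr1 (tuple0 S).
have := parity_wedge (v := u^~ x) (w := fun S => Omega G P x (tnth S 0) (tnth S 1))
  (w' := fun S : _.-tuple _ => OmegaI G P x S) parity_Omega IHr.
rewrite mulr1; apply: parity_ext => S T.
(* The length [r.+1.*2] converts to [2 + r.*2]; once the first two entries of S are exposed,
   [OmegaI] unfolds by one step. *)
have -> : S = [:: tnth S 0, tnth S 1 & rtuple (S : (2 + r.*2).-tuple _)] :> seq _.
  rewrite -[in LHS](cat_lrtuple (S : (2 + r.*2).-tuple _)) /=.
  rewrite !enum_ordSl enum_ord0 /=.
  by congr [:: tnth S _, tnth S _ & _]; exact: val_inj.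
set S' := rtuple _.
change (wedge 2 r.*2 (Omega G P x (tnth (ltuple S) 0) (tnth (ltuple S) 1))
    (OmegaI G P x S') [seq u j x | j <- T] =
  wedge 2 (size S') (Omega G P x (tnth S 0) (tnth S 1)) (OmegaI G P x S')
    [seq u j x | j <- T]).
have -> : tnth (ltuple S) 0 = tnth S 0 by rewrite tnth_mktuple; congr tnth; exact: val_inj.
have -> : tnth (ltuple S) 1 = tnth S 1 by rewrite tnth_mktuple; congr tnth; exact: val_inj.
by rewrite size_tuple.
Qed.

Lemma parity_OmegaTheta r al : @tensor_parity R d O (r.*2 + 1) (-1)
  (fun S T => OmegaTheta G P x (ltuple S) (tnth (rtuple S) 0) al [seq u j x | j <- T]).
Proof.
have := parity_wedge (v := u^~ x) (w := fun S : _.-tuple _ => OmegaI G P x S)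
  (w' := fun S => theta G P x (tg (tnth S 0)) (nm al)) (@parity_OmegaI r) (parity_theta al).
rewrite mul1r.
by apply: parity_ext => S T; rewrite /OmegaTheta size_tuple.
Qed.

(** Each normal coefficient is the trace of the odd tensor formed by Omega_I and one theta. The
    restriction to distinct indices is removed because the wedge product vanishes on repeated
    arguments. *)
Lemma mean_curv_eq0 p : mean_curv G P p x = 0.
Proof.
case: p => // s; rewrite /mean_curv; case: ifP => // _.
rewrite big1 ?scaler0 // => al _; apply/eqP; rewrite scaler_eq0; apply/orP; left.
(* The identity permutation occurs here: every upper index is contracted with the frame vector of
   the same index. *)
apply/eqP; rewrite -[RHS](odd_trace_eq0 O_orth 1%g (@parity_OmegaTheta s al)).
under [RHS]eq_bigr do rewrite ptuple1.
rewrite [RHS]big_tuple_cat; apply: eq_bigr => I _; rewrite big_tuple1 big_mkcond.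
apply: eq_bigr => a _; rewrite ltuple_cat rtuple_cat (tnth_nth a) /=.
rewrite cats1; case: ifP => // /negbT nu; rewrite /OmegaTheta size_tuple.
have := @wedge_not_uniq R d _ (u^~ x) s.*2 1 (OmegaI G P x I)
  (theta G P x (tg a) (nm al)) (cat_tuple I [tuple a]).
by rewrite /= cats1 => ->.
Qed.

(** M stands for the matrix of R_(i beta j alpha) with alpha and beta fixed. Its product with the
    odd tensor of Omega_I and theta is odd, and the Kronecker symbol turns the sum into signed full
    contractions of that product, each of them zero. *)
Lemma W_normal_eq0 r be (M : 'M[R]_d) : O *m M *m O^T = M ->
  \sum_(I : (r.*2).-tuple 'I_d) \sum_(a < d | uniq (rcons I a)) \sum_(i < d)
       \sum_(J : (r.*2.+1).-tuple 'I_d | uniq J) \sum_(j < d)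
         gkron R (I ++ [:: a; i]) (J ++ [:: j]) * M i j
         * OmegaTheta G P x I a be (es P x J) = 0.
Proof.
move=> hM.
have h1 : @tensor_parity R d O 1 1 (fun S T => M (tnth S 0) (tnth T 0)).
  by apply: parity1; rewrite scale1r.
have h2 := parity_prod (@parity_OmegaTheta r be) h1; rewrite mulr1 in h2.
transitivity (\sum_(S : (r.*2 + 1 + 1).-tuple 'I_d) \sum_(T : (r.*2 + 1 + 1).-tuple 'I_d)
   gkron R S T * (OmegaTheta G P x (ltuple (ltuple S)) (tnth (rtuple (ltuple S)) 0) be
       [seq u j x | j <- ltuple T] * M (tnth (rtuple S) 0) (tnth (rtuple T) 0))); last first.
  rewrite gkron_sum big1 // => s _.
  by rewrite (odd_trace_eq0 O_orth s h2) mulr0.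
rewrite !big_tuple_cat; apply: eq_bigr => I _; rewrite big_tuple1 big_mkcond.
apply: eq_bigr => a _; rewrite big_tuple1.
case: ifPn => nu; last first.
  symmetry; apply: big1 => i _; apply: big1 => T _.
  by rewrite gkron_uniq ?mul0r //= cat_uniq cats1 (negbTE nu).
apply: eq_bigr => i _; rewrite big_tuple_cat big_mkcond.
(* The length of J passes from [r.*2.+1] to [r.*2 + 1], the form produced by splitting off the last
   index. *)
rewrite (big_tuple_cast (fun J : seq 'I_d => if uniq J then \sum_(j < d)
  gkron R (I ++ [:: a; i]) (J ++ [:: j]) * M i j
    * OmegaTheta G P x I a be (es P x J) else 0) (esym (addn1 _))).
apply: eq_bigr => J _; rewrite big_tuple1; case: ifPn => nuJ.
  apply: eq_bigr => j _; rewrite !ltuple_cat !rtuple_cat !(tnth_nth a) /= -catA.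
  by rewrite -mulrA; congr (_ * _); rewrite mulrC.
symmetry; apply: big1 => j _.
by rewrite gkron_uniq ?mul0r //= !cat_uniq (negbTE nuJ) !andbF.
Qed.

End ParityOfCurvatureForms.

(** * Entrywise calculus of row vectors *)

Section RowVectors.
Variable R : realType.

(** These three rules open the linear operations only, so that entries of vectors such as [cJ a]
    remain atoms for [ring]. *)
Lemma row_entryD m (a' b' : 'rV[R]_m) l : (a' + b') 0 l = a' 0 l + b' 0 l.
Proof. by rewrite mxE. Qed.

Lemma row_entryN m (a' : 'rV[R]_m) l : (- a') 0 l = - a' 0 l.
Proof. by rewrite mxE. Qed.

Lemma row_entryZ m t (a' : 'rV[R]_m) l : (t *: a') 0 l = t * a' 0 l.
Proof. by rewrite mxE. Qed.

Lemma is_deriveV (V : normedModType R) (f : V -> R^o) (y v : V) (df : R) :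
  f y != 0 -> is_derive y v f df -> is_derive y v (fun t : V => (f t)^-1) (- (f y) ^- 2 * df).
Proof. by move=> f0 [fd <-]; split; [exact: derivableV|rewrite deriveV]. Qed.

Lemma is_derive_row m n (f : 'rV[R]_m -> 'rV[R]_n) (y v : 'rV[R]_m) (df : 'rV[R]_n) :
  (forall l, is_derive y v (fun t : 'rV[R]_m => f t 0 l : R^o) (df 0 l)) -> is_derive y v f df.
Proof.
move=> h; have fd : derivable f y v.
  by apply/derivable_mxP => i l; rewrite ord1; case: (h l).
split=> //; apply/rowP => l; rewrite derive_mx // mxE.
by case: (h l).
Qed.

Lemma is_derive_entry d m (f : 'rV[R]_d -> 'rV[R]_m) (x v : 'rV[R]_d) (df : 'rV[R]_m) l :
  is_derive x v f df -> is_derive x v (fun z => f z 0 l : R^o) (df 0 l).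
Proof.
move=> [fd <-]; split; first by have /derivable_mxP := fd; exact.
by rewrite derive_mx // mxE.
Qed.

End RowVectors.

(** * The metric pairing, and the divergence of a field vanishing near a point *)

Section Inner.
Variables (R : realType) (D : nat) (G : 'rV[R]_D -> 'M[R]_D) (y : 'rV[R]_D).

Lemma innerZDl t a b w : inner G y (t *: a + b) w = t * inner G y a w + inner G y b w.
Proof. by rewrite /inner !mulmxDl -!scalemxAl !mxE. Qed.

Lemma inner0l w : inner G y 0 w = 0.
Proof. by rewrite /inner !mul0mx mxE. Qed.

Lemma innerNl a w : inner G y (- a) w = - inner G y a w.
Proof. by rewrite -scaleN1r -[-1 *: a]addr0 innerZDl inner0l addr0 mulN1r. Qed.

Lemma inner0r w : inner G y w 0 = 0.
Proof. by rewrite /inner trmx0 mulmx0 mxE. Qed.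

Lemma inner_suml (I : finType) (t : I -> R) (a : I -> 'rV[R]_D) w :
  inner G y (\sum_i t i *: a i) w = \sum_i t i * inner G y (a i) w.
Proof.
apply: (big_rec2 (fun s r => inner G y s w = r)); first exact: inner0l.
by move=> i s r _ <-; rewrite innerZDl.
Qed.

End Inner.

Lemma christoffel0r (R : realType) D (G : 'rV[R]_D -> 'M[R]_D) y a : christoffel G y a 0 = 0.
Proof.
rewrite /christoffel; have -> : \row_l koszul G y a 0 (delta_mx 0 l) = 0.
  apply/rowP => l; rewrite !mxE /koszul derive0.
  have -> : (fun z => inner G z 0 (delta_mx 0 l)) = cst 0 by apply/funext => z; exact: inner0l.
  have -> : (fun z => inner G z a 0) = cst 0 by apply/funext => z; exact: inner0r.
  by rewrite !derive_cst addr0 subr0 mulr0.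
by rewrite mul0mx.
Qed.

Lemma divergence_near0 (R : realType) D (G : 'rV[R]_D -> 'M[R]_D)
    (Y : 'rV[R]_D -> 'rV[R]_D) y :
  (\forall z \near y, Y z = 0) -> divergence G Y y = 0.
Proof.
move=> Y0; rewrite /divergence big1 // => l _.
rewrite (nbhs_singleton Y0) christoffel0r addr0.
have -> : 'D_(delta_mx 0 l) Y y = 'D_(delta_mx 0 l) (cst 0) y by exact: near_eq_derive.
by rewrite derive_cst mxE.
Qed.

(** * The Fubini-Study metric *)

Section DotProduct.
Variable R : realType.

Lemma dotE m (a b : 'rV[R]_m) : dot a b = \sum_i a 0 i * b 0 i.
Proof. by rewrite /dot mxE; apply: eq_bigr => i _; rewrite mxE. Qed.

Lemma dotC m (a b : 'rV[R]_m) : dot a b = dot b a.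
Proof. by rewrite !dotE; apply: eq_bigr => i _; rewrite mulrC. Qed.

Lemma dotDl m (a b w : 'rV[R]_m) : dot (a + b) w = dot a w + dot b w.
Proof. by rewrite /dot mulmxDl mxE. Qed.

Lemma dotZl m (t : R) (a w : 'rV[R]_m) : dot (t *: a) w = t * dot a w.
Proof. by rewrite /dot -scalemxAl mxE. Qed.

Lemma dotNl m (a w : 'rV[R]_m) : dot (- a) w = - dot a w.
Proof. by rewrite -scaleN1r dotZl mulN1r. Qed.

Lemma dotNr m (a w : 'rV[R]_m) : dot w (- a) = - dot w a.
Proof. by rewrite dotC dotNl dotC. Qed.

Lemma dot_ge0 m (a : 'rV[R]_m) : 0 <= dot a a.
Proof. by rewrite dotE; apply: sumr_ge0 => i _; rewrite -expr2 sqr_ge0. Qed.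

Lemma dot_delta m i (a : 'rV[R]_m) : dot (delta_mx 0 i) a = a 0 i.
Proof.
rewrite dotE (bigD1 i) //= mxE !eqxx mul1r big1 ?addr0 // => j /negbTE ji.
by rewrite mxE ji mul0r.
Qed.

Lemma dot_row_mx m m' (a b : 'rV[R]_m) (a' b' : 'rV[R]_m') :
  dot (row_mx a a') (row_mx b b') = dot a b + dot a' b'.
Proof. by rewrite /dot tr_row_mx mul_row_col mxE. Qed.

Lemma cJD N (v w : 'rV[R]_(N + N)) : cJ (v + w) = cJ v + cJ w.
Proof. by rewrite -[v]scale1r cJZD !scale1r. Qed.

Lemma cJ0 N : cJ (0 : 'rV[R]_(N + N)) = 0.
Proof. by apply: (addrI (cJ 0)); rewrite -cJD !addr0. Qed.

Lemma cJZ N (t : R) (v : 'rV[R]_(N + N)) : cJ (t *: v) = t *: cJ v.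
Proof. by rewrite -[t *: v]addr0 cJZD cJ0 addr0. Qed.

Lemma dot_cJ N (v w : 'rV[R]_(N + N)) : dot (cJ v) (cJ w) = dot v w.
Proof.
by rewrite /cJ dot_row_mx dotNl dotNr opprK addrC -dot_row_mx !hsubmxK.
Qed.

Lemma dot_cJl N (v w : 'rV[R]_(N + N)) : dot (cJ v) w = - dot v (cJ w).
Proof. by rewrite -dot_cJ cJK dotNl. Qed.

Lemma dot_cJC N (v w : 'rV[R]_(N + N)) : dot v (cJ w) = - dot w (cJ v).
Proof. by rewrite dotC dot_cJl. Qed.

Lemma dot_cJ0 N (v : 'rV[R]_(N + N)) : dot v (cJ v) = 0.
Proof. by apply/eqP; rewrite -eqNr -dot_cJC. Qed.

End DotProduct.

Section FubiniStudyMetric.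
Variables (R : realType) (N : nat) (c : R) (k : 'I_N.+1).
Hypothesis c_gt0 : 0 < c.
Implicit Types (y a b w v z : 'rV[R]_(N + N)).

Local Notation g := (inner (fs_metric c k)).

Lemma dot_insert_row s t (v w : 'rV[R]_N) :
  dot (insert_row k s v) (insert_row k t w) = s * t + dot v w.
Proof.
rewrite !dotE (bigD1_ord k) //= !mxE unlift_none /=; congr (_ + _).
by apply: eq_bigr => i _; rewrite !mxE liftK.
Qed.

Lemma dot_homog s t a b : dot (homog k s a) (homog k t b) = s * t + dot a b.
Proof.
rewrite /homog dot_row_mx !dot_insert_row mul0r add0r -addrA -dot_row_mx.
by rewrite !hsubmxK.
Qed.

Lemma dot_homog_cJ t a b : dot (homog k 0 a) (cJ (homog k t b)) = dot a (cJ b).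
Proof.
rewrite /homog /cJ row_mxKl row_mxKr dot_row_mx dotNr !dot_insert_row !mul0r !add0r.
by rewrite -dotNr -dot_row_mx hsubmxK.
Qed.

(** The squared norm of the homogeneous vector [homog k 1 y]. *)
Definition fs_den y : R := 1 + dot y y.

Lemma fs_den_gt0 y : 0 < fs_den y.
Proof. by rewrite ltr_pwDl // dot_ge0. Qed.

Lemma fs_den_neq0 y : fs_den y != 0.
Proof. by rewrite gt_eqF // fs_den_gt0. Qed.

Lemma fs_metricE y : fs_metric c k y =
  (4%:R / c / fs_den y ^+ 2) *: (fs_den y *: 1%:M - y^T *m y - (cJ y)^T *m cJ y).
Proof.
apply/matrixP => i j; rewrite !mxE /fubini_study !dot_homog !dot_homog_cJ.
rewrite mulr1 !mul0r !add0r !dot_delta !mxE !big_ord1 !mxE.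
rewrite -/(fs_den y) [_ == j]eq_sym /= [RHS]mulrAC.
by rewrite eq_sym.
Qed.

Lemma fs_innerE y a b : g y a b =
  4%:R / c / fs_den y ^+ 2 *
    (fs_den y * dot a b - dot a y * dot b y - dot a (cJ y) * dot b (cJ y)).
Proof.
have rank1 (v : 'rV[R]_(N + N)) : (a *m (v^T *m v) *m b^T) 0 0 = dot a v * dot b v.
  by rewrite [dot b v]dotC /dot mulmxA -[_ *m v *m _]mulmxA mxE big_ord1.
rewrite /inner fs_metricE -scalemxAr -scalemxAl mxE; congr (_ * _).
rewrite !mulmxBr !mulmxBl -scalemxAr -scalemxAl mulmx1 -!rank1 /dot.
have mB (A B : 'M[R]_1) : (A - B) 0 0 = A 0 0 - B 0 0 by rewrite !mxE.
have mZ t (A : 'M[R]_1) : (t *: A) 0 0 = t * A 0 0 by rewrite mxE.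
by rewrite !mB mZ.
Qed.

Lemma inner_fsC y a b : g y a b = g y b a.
Proof.
rewrite !fs_innerE [dot b a]dotC; congr (_ * _).
by rewrite [dot b y * _]mulrC [dot b (cJ y) * _]mulrC.
Qed.

Lemma inner_cJ y a b : g y (cJ a) (cJ b) = g y a b.
Proof.
rewrite !fs_innerE !dot_cJ !dot_cJl mulrNN; congr (_ * _).
by rewrite -!addrA; congr (_ + _); rewrite addrC.
Qed.

(** A row a of the kernel pairs to zero with every vector. Testing with y and [cJ y] gives
    [dot a y = 0] and [dot a (cJ y) = 0], because [fs_den y] exceeds [dot y y] by 1; testing with a
    itself then gives [dot a a = 0]. *)
Lemma fs_metric_unit y : fs_metric c k y \in unitmx.
Proof.
rewrite -row_free_unit -kermx_eq0; apply/eqP/row_matrixP => i; rewrite row0.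
set a := row i _.
have ga b : g y a b = 0.
  by rewrite /inner /a -row_mul mulmx_ker row0 mul0mx mxE.
have f0 : 4%:R / c / fs_den y ^+ 2 != 0.
  by rewrite !mulf_neq0 ?invr_neq0 ?expf_neq0 ?fs_den_neq0 ?pnatr_eq0 ?gt_eqF.
have h b : fs_den y * dot a b - dot a y * dot b y - dot a (cJ y) * dot b (cJ y) = 0.
  by apply/eqP; have /eqP := ga b; rewrite fs_innerE mulf_eq0 (negbTE f0).
have a1 : dot a y = 0.
  by rewrite -[RHS](h y) dot_cJ0 mulr0 subr0 /fs_den mulrDl mul1r mulrC addrK.
have a2 : dot a (cJ y) = 0.
  rewrite -[RHS](h (cJ y)) dot_cJ [dot (cJ y) y]dotC dot_cJ0 mulr0 subr0.
  by rewrite /fs_den mulrDl mul1r mulrC addrK.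
have : dot a a == 0.
  move: (h a); rewrite a1 a2 !mul0r !subr0 => /eqP.
  by rewrite mulf_eq0 (negbTE (fs_den_neq0 y)).
rewrite dotE psumr_eq0 => [/allP a0|j _]; last by rewrite -expr2 sqr_ge0.
apply/rowP => j; apply/eqP; rewrite [X in _ == X]mxE.
by have := a0 j (mem_index_enum _); rewrite /= mulf_eq0 orbb.
Qed.

Lemma is_derive_dot m (y v a : 'rV[R]_m) :
  is_derive y v (fun z : 'rV[R]_m => dot a z : R^o) (dot a v).
Proof.
have -> : (fun z : 'rV[R]_m => dot a z : R^o) =
   \sum_(i < m) (fun z : 'rV[R]_m => a 0 i *: (z 0 i : R^o)).
  by apply/funext => z; rewrite fct_sumE dotE.
rewrite dotE; apply: is_derive_sum => i.
apply: (@is_deriveZ R _ _ (fun z : 'rV[R]_m => z 0 i : R^o)).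
exact: is_derive_entry (is_derive_id _ _).
Qed.

Lemma is_derive_dot_cJ y v a :
  is_derive y v (fun z => dot a (cJ z) : R^o) (dot a (cJ v)).
Proof.
have -> : (fun z => dot a (cJ z) : R^o) = (fun z => dot (- cJ a) z : R^o).
  by apply/funext => z; rewrite dotNl dot_cJl opprK.
by rewrite -[dot a (cJ v)]opprK -dot_cJl -dotNl; exact: is_derive_dot.
Qed.

Lemma is_derive_fs_den y v :
  is_derive y v (fs_den : _ -> R^o) (2%:R * dot v y).
Proof.
have -> : (fs_den : _ -> R^o) = cst 1 +
    \sum_(i < N + N) ((fun z : 'rV[R]_(N + N) => z 0 i : R^o) ^+ 2).
  by apply/funext => z; rewrite /fs_den /= fctE fct_sumE dotE.
have h (i : 'I_(N + N)) : is_derive y v (fun z : 'rV[R]_(N + N) => z 0 i : R^o) (v 0 i).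
  exact: is_derive_entry (is_derive_id _ _).
apply: is_derive_eq.
rewrite add0r dotE mulr_sumr; apply: eq_bigr => i _ /=.
by rewrite -[LHS]/(2 * y 0 i ^+ 1 * v 0 i) expr1 -mulrA [y 0 i * _]mulrC.
Qed.

Lemma is_derive_fs_inner y v a b :
  is_derive y v (fun z => g z a b : R^o)
    (4%:R / c * (2%:R * dot v y * dot a b - dot a v * dot b y - dot a y * dot b v
                 - dot a (cJ v) * dot b (cJ y) - dot a (cJ y) * dot b (cJ v)) / fs_den y ^+ 2
     - 4%:R / c * (fs_den y * dot a b - dot a y * dot b y - dot a (cJ y) * dot b (cJ y))
       * (4%:R * dot v y) / fs_den y ^+ 3).
Proof.
have -> : (fun z => g z a b : R^o) =
   (* The pairing is rebuilt from operations on functions, so that instance search assembles its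
      derivative from the rules below. *)
   (4%:R / c) *: (((dot a b *: (fs_den : _ -> R^o))
      - (fun z => dot a z : R^o) * (fun z => dot b z : R^o)
      - (fun z => dot a (cJ z) : R^o) * (fun z => dot b (cJ z) : R^o))
      * (fun z => (fs_den z)^-1 : R^o) ^+ 2).
  apply/funext => z; rewrite fs_innerE !fctE /= -exprVn.
  rewrite /GRing.scale /=; ring.
have h1 := is_derive_fs_den y v.
have h2 := is_deriveV (fs_den_neq0 y) h1.
have h3 := is_derive_dot y v a.
have h4 := is_derive_dot y v b.
have h5 := is_derive_dot_cJ y v a.
have h6 := is_derive_dot_cJ y v b.
apply: is_derive_eq; rewrite !fctE /= /GRing.scale /=.
have := fs_den_neq0 y; have : c != 0 by rewrite gt_eqF.
by move: (fs_den y) => s c0 s0; field; rewrite s0 c0.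
Qed.

(** In complex notation this is - (<a, y> b + <b, y> a) / (1 + |y|^2), where <a, y> is the Hermitian
    product linear in a, with real part [dot a y] and imaginary part [dot a (cJ y)]. *)
Definition fs_christoffel y a b : 'rV[R]_(N + N) :=
  - (fs_den y)^-1 *: (dot a y *: b + dot a (cJ y) *: cJ b
                      + dot b y *: a + dot b (cJ y) *: cJ a).

Lemma koszul_fs y a b w : koszul (fs_metric c k) y a b w = g y (fs_christoffel y a b) w.
Proof.
rewrite /koszul.
rewrite (@derive_val _ _ _ _ _ _ _ (is_derive_fs_inner y a b w)).
rewrite (@derive_val _ _ _ _ _ _ _ (is_derive_fs_inner y b a w)).
rewrite (@derive_val _ _ _ _ _ _ _ (is_derive_fs_inner y w a b)).
rewrite fs_innerE /fs_christoffel !(dotZl, dotDl) !dot_cJl !cJK !dotNr.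
(* Symmetry of [dot] and antisymmetry of [cJ] bring each product to one orientation, so that [field]
   sees the same atoms on both sides. *)
rewrite [dot b a]dotC [dot w a]dotC [dot w b]dotC [dot b (cJ a)]dot_cJC.
rewrite [dot w (cJ a)]dot_cJC [dot w (cJ b)]dot_cJC.
have := fs_den_neq0 y; have : c != 0 by rewrite gt_eqF.
by move: (fs_den y) => s c0 s0; field; rewrite s0 c0.
Qed.

(** The row of Koszul values is [fs_christoffel] times the metric matrix, which is invertible. *)
Lemma christoffel_fs y a b : christoffel (fs_metric c k) y a b = fs_christoffel y a b.
Proof.
rewrite /christoffel -[RHS](mulmxK (fs_metric_unit y)); congr (_ *m _).
apply/rowP => l; rewrite mxE koszul_fs /inner.
by rewrite trmx_delta -colE mxE.
Qed.

Lemma is_derive_fs_christoffel y v a b :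
  is_derive y v (fun z => christoffel (fs_metric c k) z a b)
    ((2%:R * dot v y / fs_den y ^+ 2) *: (dot a y *: b + dot a (cJ y) *: cJ b
                      + dot b y *: a + dot b (cJ y) *: cJ a)
     - (fs_den y)^-1 *: (dot a v *: b + dot a (cJ v) *: cJ b
                      + dot b v *: a + dot b (cJ v) *: cJ a)).
Proof.
under eq_fun do rewrite christoffel_fs.
apply: is_derive_row => l; rewrite !(row_entryD, row_entryN, row_entryZ).
have -> : (fun z => fs_christoffel z a b 0 l : R^o) =
  - ((fun z => (fs_den z)^-1 : R^o) *
   (b 0 l *: (fun z => dot a z : R^o) + cJ b 0 l *: (fun z => dot a (cJ z) : R^o)
    + a 0 l *: (fun z => dot b z : R^o) + cJ a 0 l *: (fun z => dot b (cJ z) : R^o))).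
  apply/funext => z; rewrite !(row_entryD, row_entryN, row_entryZ) !fctE /=.
  by rewrite /GRing.scale /=; ring.
have h1 := is_derive_fs_den y v.
have h2 := is_deriveV (fs_den_neq0 y) h1.
have h3 := is_derive_dot y v a.
have h4 := is_derive_dot y v b.
have h5 := is_derive_dot_cJ y v a.
have h6 := is_derive_dot_cJ y v b.
have h := is_deriveN (is_deriveM h2 (is_deriveD (is_deriveD (is_deriveD
  (is_deriveZ (b 0 l) h3) (is_deriveZ (cJ b 0 l) h5)) (is_deriveZ (a 0 l) h4))
  (is_deriveZ (cJ a 0 l) h6))).
apply: (is_derive_eq h); rewrite !fctE /= /GRing.scale /=.
have := fs_den_neq0 y.
by move: (fs_den y) => s s0; field.
Qed.

Lemma curvature_fs y a b w :
  curvature (fs_metric c k) y a b w =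
  (c / 4%:R) *: (g y b w *: a - g y a w *: b + g y (cJ b) w *: cJ a
                 - g y (cJ a) w *: cJ b - 2%:R * g y (cJ a) b *: cJ w).
Proof.
rewrite /curvature !christoffel_fs.
rewrite (@derive_val _ _ _ _ _ _ _ (is_derive_fs_christoffel y a b w)).
rewrite (@derive_val _ _ _ _ _ _ _ (is_derive_fs_christoffel y b a w)).
(* The factor c / 4 cancels the 4 / c of the metric, and the claim becomes a polynomial identity in
   the inverse of [fs_den y] and the dot products. *)
have gE (a' b' : 'rV[R]_(N + N)) : c / 4%:R * g y a' b' = (fs_den y)^-1 * dot a' b'
    - (fs_den y)^-1 ^+ 2 * (dot a' y * dot b' y + dot a' (cJ y) * dot b' (cJ y)).
  have c0 : c != 0 by rewrite gt_eqF.
  rewrite fs_innerE; have := fs_den_neq0 y; move: (fs_den y) => s s0.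
  by field; rewrite s0 c0.
rewrite !(scalerDr, scalerN) !scalerA [_ * (2%:R * _)]mulrCA !gE {gE}.
rewrite /fs_christoffel !(cJD, cJZ, cJK).
rewrite !(dotZl, dotDl, dotNl) !dot_cJl !cJK !dotNr.
rewrite [dot b a]dotC [dot w a]dotC [dot w b]dotC [dot b (cJ a)]dot_cJC.
rewrite [dot w (cJ a)]dot_cJC [dot w (cJ b)]dot_cJC.
rewrite -exprVn; move: (fs_den y)^-1 => s.
apply/rowP => l; rewrite !(row_entryD, row_entryN, row_entryZ).
move: (a 0 l) (b 0 l) (w 0 l) (cJ a 0 l) (cJ b 0 l) (cJ w 0 l) => ? ? ? ? ? ?.
move: (dot a y) (dot b y) (dot w y) (dot a (cJ y)) (dot b (cJ y)) (dot w (cJ y)) => ? ? ? ? ? ?.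
move: (dot a b) (dot a w) (dot b w) (dot a (cJ b)) (dot a (cJ w)) (dot b (cJ w)) => ? ? ? ? ? ?.
ring.
Qed.

(** The tensor of constant holomorphic curvature c; the last term carries a minus sign because <Jv,
    w> = - <Jw, v>. *)
Lemma riemann_fs y a b w v :
  riemann (fs_metric c k) y a b w v =
  c / 4%:R * (g y b v * g y a w - g y a v * g y b w + g y (cJ b) v * g y (cJ a) w
              - g y (cJ a) v * g y (cJ b) w - 2%:R * g y (cJ a) b * g y (cJ v) w).
Proof.
have gD (a' b' : 'rV[R]_(N + N)) : g y (a' + b') w = g y a' w + g y b' w.
  by rewrite -[a']scale1r innerZDl mul1r scale1r.
have gZ (t : R) (a' : 'rV[R]_(N + N)) : g y (t *: a') w = t * g y a' w.
  by rewrite -[t *: a']addr0 innerZDl inner0l addr0.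
by rewrite /riemann curvature_fs !(gD, innerNl, gZ).
Qed.

(** The Kaehler condition: J has constant coefficients in the chart, so it is parallel exactly when
    the Christoffel symbols commute with it. *)
Lemma christoffel_fs_cJ y a b :
  christoffel (fs_metric c k) y a (cJ b) = cJ (christoffel (fs_metric c k) y a b).
Proof.
rewrite !christoffel_fs /fs_christoffel cJZ !(cJD, cJZ, cJK); congr (_ *: _).
rewrite dot_cJ dot_cJl !scalerN scaleNr -!addrA; congr (_ + (_ + _)).
by rewrite addrC.
Qed.

Lemma christoffel_fsC y a b :
  christoffel (fs_metric c k) y a b = christoffel (fs_metric c k) y b a.
Proof.
by rewrite !christoffel_fs /fs_christoffel -addrA addrC addrA -!addrA.
Qed.

Lemma christoffel_fs_suml (I : finType) (t : I -> R) (a : I -> 'rV[R]_(N + N)) y b :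
  christoffel (fs_metric c k) y (\sum_i t i *: a i) b =
  \sum_i t i *: christoffel (fs_metric c k) y (a i) b.
Proof.
have lin s (v w : 'rV[R]_(N + N)) : christoffel (fs_metric c k) y (s *: v + w) b =
    s *: christoffel (fs_metric c k) y v b + christoffel (fs_metric c k) y w b.
  rewrite !christoffel_fs /fs_christoffel !(cJD, cJZ, dotDl, dotZl).
  by apply/rowP => l; rewrite !(row_entryD, row_entryZ); ring.
apply: (big_rec2 (fun v w => christoffel (fs_metric c k) y v b = w)) => [|i v w _ <-].
  by apply: (addIr (christoffel (fs_metric c k) y 0 b));
    rewrite -{1}[christoffel _ _ _ _]scale1r -lin scale1r !add0r.
exact: lin.
Qed.

End FubiniStudyMetric.

(** * Symmetry of second derivatives *)

Section Schwarz.
Variables (R : realType) (V : normedModType R).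

Lemma is_derive_line (f : V -> R^o) (p v : V) (s : R) :
  derivable f (s *: v + p) v ->
  is_derive s 1 (fun t : R => f (t *: v + p) : R^o) ('D_v f (s *: v + p)).
Proof.
have e : (fun h : R => h^-1 *: (f ((h *: 1 + s) *: v + p) - f (s *: v + p) : R^o)) =
         (fun h : R => h^-1 *: (f (h *: v + (s *: v + p)) - f (s *: v + p) : R^o)).
  by apply/funext => h; rewrite addrA -scalerDl [h *: 1]mulr1.
move=> df; split; first by rewrite /derivable /= e.
by rewrite /derive /= e.
Qed.

(* Mean value theorem for s |-> f (x + s v + t w) - f (x + s v), followed by the
   differentiability of g at x. *)
Lemma second_difference (f g : V -> R^o) (x v w : V) (e : R) :
  (\forall z \near x, differentiable f z /\ 'D_v f z = g z) -> differentiable g x ->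
  0 < e ->
  \forall t \near (0 : R)^'+,
    `|f (t *: v + (t *: w + x)) - f (t *: v + x) - (f (t *: w + x) - f x)
      - t ^+ 2 * 'D_w g x| <= e * t ^+ 2.
Proof.
move=> fd gd e0.
(* For 0 <= s <= t the displacements s v + t w and s v have norms adding up to at most t K; the
   summand 1 keeps K positive. *)
pose K : R := `|v| + `|w| + `|v| + 1; have K0 : 0 < K by rewrite ltr_wpDl // !addr_ge0.
have := diff_locally gd => /eqaddoP /(_ (e / K)); rewrite divr_gt0 // => /(_ isT).
move=> go.
(* On the ball of radius r the derivative of f along v is g, and g has its first-order expansion at
   x with relative error e / K. *)
have [r r0 hr] : exists2 r : R, 0 < r & forall h : V, `|h| < r ->
    [/\ differentiable f (h + x), 'D_v f (h + x) = g (h + x)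
      & `|g (h + x) - g x - 'd g x h| <= e / K * `|h|].
  have : \forall h \near (0 : V), differentiable f (h + x) /\ 'D_v f (h + x) = g (h + x).
    by move/nbhs0P : fd; apply: filterS => h; rewrite addrC.
  move=> /(filterI go) /nbhs_norm0P [r r0 hr].
  exists r => // h /hr [/= h1 [h2 h3]]; split => //.
  by move: h1; rewrite /= !fctE opprD addrA.
have rK : 0 < r / K by rewrite divr_gt0.
near=> t.
have t0 : 0 < t by near: t; exact: nbhs_right_gt.
have trK : t < r / K by near: t; exact: nbhs_right_lt.
have small s : 0 <= s <= t -> `|s *: v + t *: w| < r /\ `|s *: v| < r.
  move=> /andP[s0 st].
  have h1 : `|s *: v| <= t * `|v| by rewrite normrZ ger0_norm // ler_wpM2r.
  have h2 : `|t *: w| = t * `|w| by rewrite normrZ gtr0_norm.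
  have h3 : t * K < r by rewrite -ltr_pdivlMr.
  have h4 : 0 <= t * `|v| by rewrite mulr_ge0 // ltW.
  have h5 : 0 <= t * `|w| by rewrite mulr_ge0 // ltW.
  have := ler_normD (s *: v) (t *: w); rewrite h2 /K in h3 * => h6.
  split; lra.
pose phi s := f (s *: v + (t *: w + x)) - f (s *: v + x).
have dphi s : 0 <= s <= t ->
    is_derive s 1 (phi : R -> R^o) (g (s *: v + (t *: w + x)) - g (s *: v + x)).
  move=> /small [h1 h2]; have [f1 g1 _] := hr _ h1; have [f2 g2 _] := hr _ h2.
  rewrite addrA -g1 -g2 -addrA.
  apply: is_deriveB; apply: is_derive_line; apply: diff_derivable => //.
  by rewrite addrA.
have [] := @MVT R phi (fun s => g (s *: v + (t *: w + x)) - g (s *: v + x)) 0 t t0.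
- by move=> s; rewrite in_itv /= => /andP[s0 st]; apply: dphi; rewrite !ltW.
- apply: derivable_within_continuous => s; rewrite in_itv /= => h.
  by case: (dphi s h).
move=> xi; rewrite in_itv /= => /andP[xi0 xit].
rewrite /phi !scale0r !add0r subr0 => ->.
have [s1 s2] := small xi (ltac:(rewrite !ltW //)).
have [_ _ b1] := hr _ s1; have [_ _ b2] := hr _ s2.
have gw : 'd g x (xi *: v + t *: w) - 'd g x (xi *: v) = t * 'D_w g x.
  by rewrite linearD addrAC subrr add0r deriveE //; exact: linearZ.
have h1 : `|xi *: v| <= t * `|v| by rewrite normrZ gtr0_norm // ler_wpM2r // ltW.
have h2 : `|xi *: v + t *: w| <= t * `|v| + t * `|w|.
  by apply: (le_trans (ler_normD _ _)); rewrite lerD // normrZ gtr0_norm.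
have eK : 0 <= e / K by rewrite ltW // divr_gt0.
rewrite [xi *: v + (_ + x)]addrA.
(* By linearity the differential of g accounts for the term t D_w g(x); two first-order remainders
   of g are left. *)
have -> : (g (xi *: v + t *: w + x) - g (xi *: v + x)) * t - t ^+ 2 * 'D_w g x =
   t * ((g (xi *: v + t *: w + x) - g x - 'd g x (xi *: v + t *: w)) -
        (g (xi *: v + x) - g x - 'd g x (xi *: v))).
  have -> : 'D_w g x = t^-1 * ('d g x (xi *: v + t *: w) - 'd g x (xi *: v)).
    by rewrite gw mulKf // gt_eqF.
  by field; rewrite gt_eqF.
rewrite normrM gtr0_norm // expr2 mulrCA ler_pM2l //.
apply: (le_trans (ler_normB _ _)).
apply: (le_trans (lerD b1 b2)); rewrite -mulrDr.
apply: (@le_trans _ _ (e / K * (t * K))); last first.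
  by rewrite mulrCA mulfVK ?gt_eqF // mulrC.
rewrite ler_wpM2l // /K; lra.
Unshelve. all: by end_near.
Qed.

(** The second difference is symmetric in v and w, so t^2 D_w g and t^2 D_v h both approximate it.
    With the error constant |A - B| / 4 on each side this gives |A - B| <= |A - B| / 2, which is
    absurd for A != B. *)
Lemma derive_comm (f g h : V -> R^o) (x v w : V) :
  (\forall z \near x, [/\ differentiable f z, 'D_v f z = g z & 'D_w f z = h z]) ->
  differentiable g x -> differentiable h x ->
  'D_v h x = 'D_w g x.
Proof.
have aux (X : R) : X <= X / 2%:R -> 0 < X / 4%:R -> False by lra.
move=> fd dv dw; apply/eqP; apply: contraT => ne.
set A := 'D_v _ x in ne *; set B := 'D_w _ x in ne *.
have e0 : 0 < `|A - B| / 4%:R by rewrite divr_gt0 // normr_gt0 subr_eq0.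
have f1 : \forall z \near x, differentiable f z /\ 'D_v f z = g z.
  by apply: filterS fd => z [].
have f2 : \forall z \near x, differentiable f z /\ 'D_w f z = h z.
  by apply: filterS fd => z [].
have n1 := second_difference w f1 dv e0; have n2 := second_difference v f2 dw e0.
have [t /= [[h1 h2] t0]] := filter_ex (filterI (filterI n1 n2) (nbhs_right_gt 0)).
rewrite -/A in h2; rewrite -/B in h1.
have t2 : 0 < t ^+ 2 by rewrite exprn_gt0.
have : t ^+ 2 * `|A - B| <= t ^+ 2 * (`|A - B| / 2%:R).
  rewrite -{1}(gtr0_norm t2) -normrM [leRHS](_ : _ =
    `|A - B| / 4%:R * t ^+ 2 + `|A - B| / 4%:R * t ^+ 2); last by field.
  apply: le_trans (lerD h1 h2); apply: le_trans (ler_normB _ _).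
  rewrite le_eqVlt; apply/orP; left; apply/eqP; congr `|_|.
  by rewrite [t *: w + (t *: v + x)]addrCA; ring.
rewrite ler_pM2l // => le; exfalso.
exact: aux le e0.
Qed.

End Schwarz.

(** * Derivatives of vector-valued maps along fields *)

Section DerivativeOfRows.
Variables (R : realType) (d m : nat).
Implicit Types (f : 'rV[R]_d -> 'rV[R]_m) (x v w : 'rV[R]_d).

Lemma derive_dir_sum f x (I : finType) (t : I -> R) (a : I -> 'rV[R]_d) :
  differentiable f x -> 'D_(\sum_i t i *: a i) f x = \sum_i t i *: 'D_(a i) f x.
Proof.
move=> fd; rewrite deriveE // linear_sum; apply: eq_bigr => i _.
by rewrite linearZ deriveE.
Qed.

Lemma derive_rowE f x w : differentiable f x ->
  'D_w f x = \sum_l w 0 l *: 'D_(delta_mx 0 l) f x.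
Proof. by move=> fd; rewrite {1}(row_sum_delta w) derive_dir_sum. Qed.

Lemma is_derive_along_field f (Y : 'rV[R]_d -> 'rV[R]_d) x v (dY : 'rV[R]_d) :
  (\forall z \near x, differentiable f z) ->
  (forall w, differentiable ('D_w f) x) ->
  is_derive x v Y dY ->
  is_derive x v (fun z => 'D_(Y z) f z) ('D_v ('D_(Y x) f) x + 'D_dY f x).
Proof.
move=> fd f2d Yd.
(* The product rule in coordinates: Z is expanded in the standard basis, whose vectors are constant
   directions. *)
have key (Z : 'rV[R]_d -> 'rV[R]_d) (dZ : 'rV[R]_d) : is_derive x v Z dZ ->
  is_derive x v (fun z => 'D_(Z z) f z)
    (\sum_l Z x 0 l *: 'D_v ('D_(delta_mx 0 l) f) x + 'D_dZ f x).
  move=> Zd; apply: (@near_eq_is_derive _ _ _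
      (fun z => \sum_l Z z 0 l *: 'D_(delta_mx 0 l) f z)).
    by apply: filterS fd => z fz; rewrite -derive_rowE.
  apply: is_derive_row => i.
  have -> : (fun t => (\sum_l Z t 0 l *: 'D_(delta_mx 0 l) f t) 0 i : R^o) =
      \sum_(l < d) ((fun t => Z t 0 l : R^o) * (fun t => 'D_(delta_mx 0 l) f t 0 i : R^o)).
    apply/funext => t; rewrite fct_sumE summxE; apply: eq_bigr => l _.
    by rewrite mxE.
  rewrite mxE summxE (derive_rowE _ (nbhs_singleton fd)) summxE -big_split /=.
  apply: is_derive_sum => l.
  have h1 := is_derive_entry l Zd.
  have h2 : is_derive x v (fun t => 'D_(delta_mx 0 l) f t 0 i : R^o)
      ('D_v ('D_(delta_mx 0 l) f) x 0 i).
    by apply/is_derive_entry/derivableP; exact: diff_derivable.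
  apply: (is_derive_eq (is_deriveM h1 h2)).
  by rewrite !row_entryZ; congr (_ + _); exact: mulrC.
apply: (is_derive_eq (key _ _ Yd)); congr (_ + _).
(* The coordinate rule applied to the constant field Y x reassembles the sum of second
   derivatives. *)
have -> : 'D_v ('D_(Y x) f) x =
    \sum_l Y x 0 l *: 'D_v ('D_(delta_mx 0 l) f) x + 'D_0 f x.
  by case: (key (cst (Y x)) 0 (is_derive_cst _ _ _)).
by rewrite derive0 addr0.
Qed.

End DerivativeOfRows.

Lemma is_derive_cJ (R : realType) d N (f : 'rV[R]_d -> 'rV[R]_(N + N)) x v df :
  is_derive x v f df -> is_derive x v (fun z => cJ (f z)) (cJ df).
Proof.
move=> fd; apply: is_derive_row => l; case: (split_ordP l) => j ->.
  rewrite row_mxEl !mxE.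
  under eq_fun do rewrite row_mxEl !mxE.
  exact: (is_deriveN (is_derive_entry _ fd)).
rewrite row_mxEr !mxE.
under eq_fun do rewrite row_mxEr !mxE.
exact: is_derive_entry.
Qed.

Lemma derive_row_comm (R : realType) d m (f : 'rV[R]_d -> 'rV[R]_m) x v w :
  (\forall z \near x, differentiable f z) ->
  (forall w, differentiable ('D_w f) x) ->
  'D_v ('D_w f) x = 'D_w ('D_v f) x.
Proof.
move=> fd f2d; apply/rowP => l.
have entry (g : 'rV[R]_d -> 'rV[R]_m) z u : differentiable g z ->
    'D_u (fun z => g z 0 l : R^o) z = 'D_u g z 0 l.
  by move=> gd; rewrite derive_mx ?mxE //; exact: diff_derivable.
have entryd (g : 'rV[R]_d -> 'rV[R]_m) z : differentiable g z ->
    differentiable (fun z => g z 0 l : R^o) z.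
  move=> gd; apply: (@differentiable_comp _ _ _ _ g (fun M : 'rV[R]_m => M 0 l : R^o)) => //.
  exact: differentiable_coord.
have e1 := entry _ _ v (f2d w); have e2 := entry _ _ w (f2d v).
apply: (etrans (esym e1)); apply: (etrans _ e2).
apply: (@derive_comm _ _ (fun z => f z 0 l : R^o)).
- by apply: filterS fd => z fz; split; [exact: entryd|exact: entry|exact: entry].
- exact: entryd (f2d v).
- exact: entryd (f2d w).
Qed.

(** * Complex submanifolds *)

Section ComplexSubmanifold.
Variables (R : realType) (n N q : nat) (c : R) (k : 'I_N.+1).
Variables (U : set 'rV[R]_(n + n)) (P : framed_patch R (n + n) q (N + N)).

Local Notation G := (fs_metric c k).
Local Notation F := (patch_map P).
Local Notation u := (tangent_fields P).
Local Notation nu := (normal_fields P).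
Local Notation tg := (lshift q).
Local Notation nm := (@rshift (n + n) q).

Hypotheses (c_gt0 : 0 < c) (U_open : open U) (F_smooth : smooth_on U F).
Hypothesis F_hol : forall x, U x -> forall v, 'D_(cJ v) F x = cJ ('D_v F x).
Hypothesis P_frame : adapted_frame G P U.

Lemma near_domain x : U x -> \forall z \near x, U z.
Proof. by move=> Ux; exact: open_nbhs_nbhs. Qed.

Lemma smooth_differentiable x : U x -> differentiable F x.
Proof. exact: (F_smooth [::]). Qed.

Lemma smooth_differentiable2 x w : U x -> differentiable ('D_w F) x.
Proof. exact: (F_smooth [:: w]). Qed.

Lemma near_smooth x : U x -> \forall z \near x, differentiable F z.
Proof. by move=> Ux; apply: filterS (near_domain Ux) => z; exact: smooth_differentiable. Qed.

Lemma frame_tg i x : frame P (tg i) x = 'D_(u i x) F x.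
Proof. by rewrite /frame (unsplitK (inl i)). Qed.

Section AtPoint.
Variable x : 'rV[R]_(n + n).
Hypothesis Ux : U x.

Local Notation g := (inner G (F x)).
Local Notation e := (fun i => frame P (tg i) x).
Local Notation nux := (fun al => frame P (nm al) x).

Lemma frame_orth A B : g (frame P A x) (frame P B x) = (A == B)%:R.
Proof. by case: P_frame => _ _; apply. Qed.

Lemma derive_F_sum (I : finType) (t : I -> R) (a : I -> 'rV[R]_(n + n)) :
  'D_(\sum_i t i *: a i) F x = \sum_i t i *: 'D_(a i) F x.
Proof.
exact: derive_dir_sum (smooth_differentiable Ux).
Qed.

Definition frame_mx : 'M[R]_(n + n) := \matrix_i u i x.

Lemma mul_frame_mx (a : 'rV[R]_(n + n)) : a *m frame_mx = \sum_i a 0 i *: u i x.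
Proof. by rewrite mulmx_sum_row; apply: eq_bigr => i _; rewrite rowK. Qed.

(** A linear relation among the u_i is carried by dF to one among the orthonormal e_i, hence is
    trivial. *)
Lemma frame_mx_unit : frame_mx \in unitmx.
Proof.
rewrite -row_free_unit -kermx_eq0; apply/eqP/row_matrixP => i; rewrite row0.
set a := row i _; have a0 : a *m frame_mx = 0 by rewrite /a -row_mul mulmx_ker row0.
apply/rowP => j; rewrite [RHS]mxE -[RHS](inner0l G (F x) (e j)).
have <- : \sum_i a 0 i *: e i = 0.
  under eq_bigr do rewrite frame_tg.
  by rewrite -derive_F_sum -mul_frame_mx a0 derive0.
rewrite inner_suml (bigD1 j) //= frame_orth eqxx mulr1 big1 ?addr0 // => i' ne.
by rewrite frame_orth (inj_eq (@lshift_inj _ _)) (negbTE ne) mulr0.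
Qed.

(** Row i holds the coordinates of J u_i in the basis u_j. Since dF is complex linear, the same
    matrix represents J on the e_i. *)
Definition J_mx : 'M[R]_(n + n) := (\matrix_i cJ (u i x)) *m invmx frame_mx.

Lemma cJ_tangent i : cJ (u i x) = \sum_j J_mx i j *: u j x.
Proof.
have -> : \sum_j J_mx i j *: u j x = row i J_mx *m frame_mx.
  by rewrite mul_frame_mx; apply: eq_bigr => j _; rewrite [row _ _ _ _]mxE.
by rewrite -row_mul mulmxKV ?frame_mx_unit // rowK.
Qed.

Lemma cJ_frame i : cJ (e i) = \sum_j J_mx i j *: e j.
Proof.
under eq_bigr do rewrite frame_tg.
by rewrite frame_tg -F_hol // -derive_F_sum -cJ_tangent.
Qed.

Lemma inner_cJ_frame i j : g (cJ (e i)) (e j) = J_mx i j.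
Proof.
rewrite cJ_frame inner_suml (bigD1 j) //= frame_orth eqxx mulr1 big1 ?addr0 // => i' ne.
by rewrite frame_orth (inj_eq (@lshift_inj _ _)) (negbTE ne) mulr0.
Qed.

(** J is an isometry of the metric, so the J e_i are orthonormal; this is the product in the other
    order, exchanged by [mulmx1C]. *)
Lemma J_mx_orth : J_mx^T *m J_mx = 1%:M.
Proof.
apply: mulmx1C; apply/matrixP => i j; rewrite [LHS]mxE [RHS]mxE.
have := frame_orth (tg i) (tg j); rewrite (inj_eq (@lshift_inj _ _)) => <-.
rewrite -inner_cJ [cJ (e i)]cJ_frame inner_suml; apply: eq_bigr => l _.
by rewrite [_^T _ _]mxE [in RHS]inner_fsC // inner_cJ_frame.
Qed.

Lemma inner_cJ_tangent_normal i al : g (cJ (e i)) (nux al) = 0.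
Proof.
by rewrite cJ_frame inner_suml big1 // => j _; rewrite frame_orth eq_lrshift mulr0.
Qed.

Lemma inner_cJ_normal_tangent i al : g (cJ (nux al)) (e i) = 0.
Proof.
by rewrite -inner_cJ cJK innerNl inner_fsC inner_cJ_tangent_normal oppr0.
Qed.

(** Each term of the curvature formula pairs the normal vector with a tangent one, possibly through
    J. *)
Lemma Rm_tangent_normal i al j l : Rm G P x (tg i) (nm al) (tg j) (tg l) = 0.
Proof.
rewrite /Rm riemann_fs // !frame_orth inner_cJ_tangent_normal.
rewrite !inner_cJ_normal_tangent eq_rlshift eq_rlshift.
by rewrite !(mulr0, mul0r, subr0, addr0).
Qed.

Definition Rm_normal_mx al be : 'M[R]_(n + n) :=
  (c / 4%:R) *: ((be == al)%:R *: 1%:M + g (cJ (nux be)) (nux al) *: J_mx).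

Lemma Rm_normal i be j al :
  Rm G P x (tg i) (nm be) (tg j) (nm al) = Rm_normal_mx al be i j.
Proof.
rewrite /Rm riemann_fs // !frame_orth inner_cJ_frame !inner_cJ_tangent_normal.
rewrite inner_cJ_normal_tangent eq_lrshift eq_rlshift.
rewrite (inj_eq (@lshift_inj _ _)) (inj_eq (@rshift_inj _ _)).
have -> : Rm_normal_mx al be i j =
    c / 4%:R * ((be == al)%:R * (i == j)%:R + g (cJ (nux be)) (nux al) * J_mx i j).
  by rewrite /Rm_normal_mx; move: J_mx => J; rewrite !mxE.
by rewrite !(mulr0, mul0r, subr0, addr0).
Qed.

Lemma Rm_normal_invariant al be :
  J_mx *m Rm_normal_mx al be *m J_mx^T = Rm_normal_mx al be.
Proof.
rewrite /Rm_normal_mx -scalemxAr -scalemxAl mulmxDr mulmxDl.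
rewrite -!scalemxAr -!scalemxAl mulmx1 -[J_mx *m J_mx *m _]mulmxA.
by rewrite (mulmx1C J_mx_orth) mulmx1.
Qed.

(** The ambient covariant derivative of dF(w) along dF(v) for constant v and w. Its normal
    components are those of the second fundamental form; the tangential part is kept. *)
Definition snd_fund v w : 'rV[R]_(N + N) :=
  'D_v ('D_w F) x + christoffel G (F x) ('D_v F x) ('D_w F x).

(** Second derivatives commute and the connection is torsion-free. *)
Lemma snd_fund_sym v w : snd_fund v w = snd_fund w v.
Proof.
have h1 := derive_row_comm v w (near_smooth Ux) (fun z => smooth_differentiable2 z Ux).
have h2 := christoffel_fsC k c_gt0 (F x) ('D_v F x) ('D_w F x).
exact: (f_equal2 +%R h1 h2).
Qed.

Lemma snd_fund_cJr v w : snd_fund v (cJ w) = cJ (snd_fund v w).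
Proof.
rewrite /snd_fund F_hol // christoffel_fs_cJ // cJD; congr (_ + _).
(* The Cauchy-Riemann identity holds near x, so it may be differentiated. *)
have -> : 'D_v ('D_(cJ w) F) x = 'D_v (fun z => cJ ('D_w F z)) x.
  by apply: near_eq_derive; apply: filterS (near_domain Ux) => z Uz; exact: F_hol.
have : is_derive x v ('D_w F) ('D_v ('D_w F) x).
  by apply: derivableP; apply: diff_derivable; exact: smooth_differentiable2.
by move=> /is_derive_cJ [].
Qed.

(** Complex linearity in one argument and symmetry give it in both, and J^2 = -1. *)
Lemma snd_fund_cJ v w : snd_fund (cJ v) (cJ w) = - snd_fund v w.
Proof. by rewrite snd_fund_cJr snd_fund_sym snd_fund_cJr cJK snd_fund_sym. Qed.

Lemma snd_fund_suml (I : finType) (t : I -> R) (a : I -> 'rV[R]_(n + n)) w :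
  snd_fund (\sum_i t i *: a i) w = \sum_i t i *: snd_fund (a i) w.
Proof.
rewrite /snd_fund (derive_dir_sum _ _ (smooth_differentiable2 w Ux)) derive_F_sum.
rewrite (christoffel_fs_suml k c_gt0) -big_split.
by apply: eq_bigr => i _; rewrite scalerDr.
Qed.

Lemma snd_fund_sumr (I : finType) (t : I -> R) (a : I -> 'rV[R]_(n + n)) v :
  snd_fund v (\sum_i t i *: a i) = \sum_i t i *: snd_fund v (a i).
Proof. by rewrite snd_fund_sym snd_fund_suml; apply: eq_bigr => i _; rewrite snd_fund_sym. Qed.

Lemma inner_tangent_normal w al : g ('D_w F x) (nux al) = 0.
Proof.
rewrite -(mulmxKV frame_mx_unit w) mul_frame_mx derive_F_sum inner_suml big1 // => i _.
by rewrite -frame_tg frame_orth eq_lrshift mulr0.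
Qed.

Lemma theta_normal a al v :
  theta G P x (tg a) (nm al) [:: v] = g (snd_fund v (u a x)) (nux al).
Proof.
rewrite /theta /one_form /= /cov.
have ud : differentiable (u a) x by case: P_frame => us _ _; exact: (us a [::]).
have -> : frame P (tg a) = fun z => 'D_(u a z) F z.
  by apply/funext => z; rewrite frame_tg.
have uD : is_derive x v (u a) ('D_v (u a) x) by apply: derivableP; exact: diff_derivable.
have [_ ->] := is_derive_along_field (near_smooth Ux)
  (fun w => smooth_differentiable2 w Ux) uD.
(* The variation of the field u_a contributes only the tangent vector dF(D_v u_a), which is
   orthogonal to the normal frame. *)
transitivity (g (1 *: snd_fund v (u a x) + 'D_('D_v (u a) x) F x) (nux al)).
  by rewrite scale1r /snd_fund [in RHS]addrAC.
by rewrite innerZDl mul1r inner_tangent_normal addr0.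
Qed.

(** The entries of the matrix product are the values h(J u_b, J u_a), expanded by bilinearity. *)
Lemma second_form_J_odd al :
  J_mx *m second_form G P x al *m J_mx^T = (-1) *: second_form G P x al.
Proof.
pose h v w := g (snd_fund v w) (nux al).
have hE a b : second_form G P x al a b = h (u b x) (u a x) by rewrite mxE theta_normal.
apply/matrixP => a b; rewrite [RHS]mxE hE mulN1r.
transitivity (h (cJ (u b x)) (cJ (u a x))); last first.
  by rewrite /h snd_fund_cJ innerNl.
rewrite (cJ_tangent a) (cJ_tangent b) /h snd_fund_sumr inner_suml [LHS]mxE.
transitivity (\sum_j \sum_i J_mx a i * (J_mx b j * h (u j x) (u i x))).
  apply: eq_bigr => j _; rewrite [_^T _ _]mxE [X in X * _]mxE big_distrl /=.
  by apply: eq_bigr => i _; rewrite hE mulrAC mulrA.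
rewrite exchange_big; apply: eq_bigr => i _ /=.
by rewrite snd_fund_suml inner_suml mulr_sumr.
Qed.

End AtPoint.

(** * Vanishing of each term of [EL] on a complex submanifold *)

Lemma mean_curv_complex p x : U x -> mean_curv G P p x = 0.
Proof.
by move=> Ux; apply: mean_curv_eq0 (J_mx_orth Ux) (second_form_J_odd Ux) _.
Qed.

Lemma q_coef_complex p i al x : U x -> q_coef G P p i al x = 0.
Proof.
move=> Ux; case: p => // r; rewrite /q_coef big1 ?add0r => [|I _].
  case: r => [|s]; first by rewrite mulr0.
  rewrite big1 ?mulr0 // => I _; do 2! (apply: big1 => ? _).
  do 4! (apply: big1 => ? _).
  by rewrite big1 ?mulr0 // => be _; rewrite Rm_tangent_normal // mulr0 mul0r.
do 4! (apply: big1 => ? _).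
by rewrite Rm_tangent_normal // mulr0 mul0r.
Qed.

Lemma Qtilde_complex p x : U x -> Qtilde G P p x = 0.
Proof.
move=> Ux; rewrite /Qtilde big1 ?sub0r => [|i _].
  rewrite big1 ?oppr0 // => al _; rewrite divergence_near0 ?scale0r //.
  (* The coefficients q vanish on all of U, a neighbourhood of x, so the field whose divergence is
     taken is locally zero. *)
  apply: filterS (near_domain Ux) => z Uz.
  by rewrite big1 // => i _; rewrite q_coef_complex // scale0r.
apply: big1 => A _; rewrite /Q big1 ?inner0l ?scale0r // => al _.
by rewrite q_coef_complex // scale0r.
Qed.

Lemma W_complex p x : U x -> W G P p x = 0.
Proof.
move=> Ux; case: p => // r; rewrite /W big1 ?scaler0 ?add0r => [|al _].
  (* Tangential part: both curvature factors have one normal and three tangent indices. *)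
  rewrite big1 ?scaler0 // => al _; do 6! (apply: big1 => ? _).
  rewrite big1 => [|j _]; last by rewrite Rm_tangent_normal // mulr0 mul0r.
  by rewrite Rm_tangent_normal // mulr0 mul0r subr0 scale0r.
(* Normal part: for fixed alpha and beta the curvature factor is a J-invariant matrix. *)
apply: big1 => be _.
under eq_bigr do under eq_bigr do under eq_bigr do under eq_bigr do under eq_bigr do
  rewrite Rm_normal //.
rewrite (W_normal_eq0 (J_mx_orth Ux) (second_form_J_odd Ux)) ?scale0r //.
exact: Rm_normal_invariant.
Qed.

Lemma EL_complex p x : U x -> EL G P p x = 0.
Proof.
move=> Ux; rewrite /EL mean_curv_complex // W_complex // Qtilde_complex //.
by rewrite !scaler0 oppr0 !addr0.
Qed.

End ComplexSubmanifold.

(** L_(2p) and both mean curvature fields vanish separately, which gives the two equalities and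
    relative minimality at once. *)
Theorem theorem4p3 (R : realType) (n m : nat) (c : R) (M : set (CP R (n + m)))
  (c_gt0 : 0 < c) (hM : closed_complex_submanifold n M) (p : nat) (hp : (p <= n)%N) :
  (forall (k : 'I_(n + m).+1) (U : set 'rV[R]_(n + n))
          (P : framed_patch R (n + n) (m + m) ((n + m) + (n + m))),
     framed_param c M k U P ->
     forall x : 'rV[R]_(n + n), U x ->
       EL (fs_metric c k) P p x
       = - ((2 * n - 2 * p)%:R *: mean_curv (fs_metric c k) P p.+1 x)
         + (c * p%:R * (2 * n - 2 * p)%:R / (2%:R * (2 * n - 2 * p + 1)%:R))
             *: mean_curv (fs_metric c k) P p x
       /\
       - ((2 * n - 2 * p)%:R *: mean_curv (fs_metric c k) P p.+1 x)
         + (c * p%:R * (2 * n - 2 * p)%:R / (2%:R * (2 * n - 2 * p + 1)%:R))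
             *: mean_curv (fs_metric c k) P p x = 0)
  /\ relatively_minimal c n (m + m) M p.
Proof.
have frameP k U (P : framed_patch R (n + n) (m + m) _) : framed_param c M k U P ->
    [/\ open U, smooth_on U (patch_map P),
        (forall x, U x -> forall v, 'D_(cJ v) (patch_map P) x = cJ ('D_v (patch_map P) x))
      & adapted_frame (fs_metric c k) P U].
  by move=> [[[Uo Fs] _ hol _ _] fr].
have EL0 k U (P : framed_patch R (n + n) (m + m) _) : framed_param c M k U P ->
    forall x, U x -> EL (fs_metric c k) P p x = 0.
  by move=> /frameP[Uo Fs hol fr] x Ux; exact: EL_complex Ux.
split; last by move=> k U P /EL0.
move=> k U P hP x Ux; rewrite (EL0 _ _ _ hP) //; case/frameP: hP => Uo Fs hol fr.
have H r : mean_curv (fs_metric c k) P r x = 0 by exact: mean_curv_complex Ux.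
by rewrite !H !scaler0 oppr0 addr0.
Qed.
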